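(* Let $f:\mathbb{R}^n\to\mathbb{R}$ and $h:\mathbb{R}^n\to\mathbb{R}^p$ be smooth, and suppose that $\mathcal{M}:=\{x\in\mathbb{R}^n : h(x)=0\}$ is an embedded submanifold of $\mathbb{R}^n$ such that the derivative $h_x(x)$ (an $n\times p$ matrix) has full rank $p$ at every $x\in\mathcal{M}$. Let $\sim$ be an equivalence relation on $\mathcal{M}$ such that $\mathcal{M}/\!\sim$ is a quotient manifold of $\mathcal{M}$, with canonical projection $\pi:\mathcal{M}\to\mathcal{M}/\!\sim$. Assume that $\mathcal{M}$ carries a Riemannian metric $\bar g$ and $\mathcal{M}/\!\sim$ carries a Riemannian metric $g$ making it a Riemannian quotient manifold of $(\mathcal{M},\bar g)$ (that is, $\pi$ is a Riemannian submersion). Assume that $f|_{\mathcal{M}}$ is constant on the equivalence classes of $\sim$ and that the induced function on $\mathcal{M}/\!\sim$, still denoted $f$, has isolated minima. Let $\mathcal{L}(x,\lambda)=f(x)-\langle\lambda,h(x)\rangle$ be the Lagrangian and $\lambda_x=(h_x(x)^Th_x(x))^{-1}h_x(x)^Tf_x(x)$. If $x^*\in\mathcal{M}$ is a local minimum of $f:\mathcal{M}\to\mathbb{R}$, then, with $\mathcal{V}_{x^*}$ the vertical space and $\mathcal{H}_{x^*}$ the horizontal space (a subspace of $T_{x^*}\mathcal{M}$ complementary to $\mathcal{V}_{x^*}$): (i) $\langle\eta_{x^*},\mathrm{D}^2\mathcal{L}(x^*,\lambda_{x^*})[\eta_{x^*}]\rangle=0$ for all $\eta_{x^*}\in\mathcal{V}_{x^*}$;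 and (ii) for all $\xi_{x^*}\in\mathcal{H}_{x^*}$, the quantity $\langle\xi_{x^*},\mathrm{D}^2\mathcal{L}(x^*,\lambda_{x^*})[\xi_{x^*}]\rangle$ captures all second-order information of $f$ on $\mathcal{M}/\!\sim$, i.e. $$\langle\xi_{x^*},\mathrm{D}^2\mathcal{L}(x^*,\lambda_{x^*})[\xi_{x^*}]\rangle=g_{[x^*]}\big(\xi_{[x^*]},\mathrm{Hess}_{[x^*]}f[\xi_{[x^*]}]\big),\qquad \xi_{[x^*]}:=\mathrm{D}\pi(x^* )[\xi_{x^*}],$$ where $\mathrm{Hess}_{[x^*]}f$ is the Riemannian Hessian at $[x^*]$ of $f$ on $(\mathcal{M}/\!\sim,g)$.
   Context: Here $\langle\cdot,\cdot\rangle$ is the Euclidean inner product. $f_x(x)\in\mathbb{R}^n$ (a column vector) and $h_x(x)\in\mathbb{R}^{n\times p}$ denote the first-order derivatives of $f$ and $h$ at $x$; thus $\mathrm{D}h(x)[\zeta]=h_x(x)^T\zeta$. $\lambda_x$ is the least-squares estimate of the Lagrange multiplier, i.e. the least-squares solution of $h_x(x)\lambda=f_x(x)$. $\mathrm{D}^2\mathcal{L}(x,\lambda_x)[\zeta]$ denotes the Euclidean second-order derivative (in $\mathbb{R}^n$) of $\mathcal{L}$ with respect to its first argument $x$, applied in the direction $\zeta\in\mathbb{R}^n$, with $\lambda$ kept fixed at the value $\lambda_x$. The equivalence class of $x$ is $[x]=\{y\in\mathcal{M}:y\sim x\}$. The vertical space $\mathcal{V}_x$ is the tangent space at $x$ of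 the equivalence class $[x]$ (equivalently the kernel of $\mathrm{D}\pi(x)$), and a horizontal space $\mathcal{H}_x$ satisfies $\mathcal{V}_x\oplus\mathcal{H}_x=T_x\mathcal{M}$. The Riemannian Hessian of $f$ is $\mathrm{Hess}f[\xi]=\nabla_\xi\,\mathrm{grad}f$ with $\nabla$ the Levi-Civita connection. ''$\mathcal{M}/\!\sim$ is a Riemannian quotient manifold'' means that $g_{[x]}(\xi_{[x]},\eta_{[x]})=\bar g_x(\xi_x,\eta_x)$ whenever $\xi_x,\eta_x$ are the vectors in the $\bar g_x$-orthogonal complement of $\mathcal{V}_x$ projecting to $\xi_{[x]},\eta_{[x]}$ under $\mathrm{D}\pi(x)$, for every representative $x$ of $[x]$. *)

(* Defs.v *)
From HB Require Import structures.
From mathcomp Require Import all_boot all_order all_algebra.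
From mathcomp Require Import all_classical all_reals all_analysis.

Set Implicit Arguments.
Unset Strict Implicit.
Unset Printing Implicit Defensive.

Import Order.TTheory GRing.Theory Num.Theory.
Import numFieldNormedType.Exports.

Local Open Scope classical_set_scope.
Local Open Scope ring_scope.

(** Points and tangent vectors of R^n are row vectors, so [v *m 'J h x] is the
    derivative of [h] at [x] in the direction [v], and ['J h x] is the n x p
    matrix usually written h_x(x) when vectors are columns. *)

Section Smoothness.
Context {R : realType} {V W : normedModType R}.

Fixpoint Ck (k : nat) (U : set V) (F : V -> W) : Prop :=
  match k with
  | 0 => forall x, U x -> {for x, continuous F}
  | k'.+1 => (forall x, U x -> differentiable F x) /\
             forall v : V, Ck k' U (fun x => 'D_v F x)
  end.

Definition smooth_on (U : set V) (F : V -> W) : Prop := forall k, Ck k U F.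

Definition smooth_at (F : V -> W) (x : V) : Prop :=
  exists U : set V, [/\ open U, U x & smooth_on U F].

End Smoothness.

Section EuclideanCalculus.
Context {R : realType}.

Definition inner {k : nat} (u v : 'rV[R]_k) : R := \sum_i u 0 i * v 0 i.

Definition euclid_grad {n : nat} (F : 'rV[R]_n -> R) (x : 'rV[R]_n) :
  'rV[R]_n := \row_i 'D_(delta_mx 0 i) (F : 'rV[R]_n -> R^o) x.

Context {n p : nat}.
Variables (f : 'rV[R]_n -> R) (h : 'rV[R]_n -> 'rV[R]_p).

Definition lagrangian (x : 'rV[R]_n) (lam : 'rV[R]_p) : R :=
  f x - inner lam (h x).

Definition lsq_multiplier (x : 'rV[R]_n) : 'rV[R]_p :=
  let hx := 'J h x in
  let fx := (euclid_grad f x)^T in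
  (invmx (hx^T *m hx) *m hx^T *m fx)^T.

Definition D2_lagrangian (x : 'rV[R]_n) (lam : 'rV[R]_p) (zeta : 'rV[R]_n) :
  'rV[R]_n := 'D_zeta (euclid_grad (fun y => lagrangian y lam)) x.

End EuclideanCalculus.

Section Submanifold.
Context {R : realType} {n : nat}.
Implicit Types (S : set 'rV[R]_n) (x v : 'rV[R]_n).

Definition embedded_submanifold S : Prop :=
  exists2 d : nat, (d <= n)%N & forall x, S x ->
    exists (U : set 'rV[R]_n) (phi psi : 'rV[R]_n -> 'rV[R]_n),
    [/\ open U /\ U x,
        smooth_on U phi,
        open (phi @` U) /\ smooth_on (phi @` U) psi,
        forall y, U y -> psi (phi y) = y &
        forall y, U y ->
          (S y <-> forall i : 'I_n, (d <= i)%N -> phi y 0 i = 0)].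

Definition sub_curve S x v (gam : R -> 'rV[R]_n) : Prop :=
  [/\ gam 0 = x,
      \forall t \near (0 : R), S (gam t),
      smooth_at (gam : R^o -> 'rV[R]_n) 0 &
      derive1 gam 0 = v].

Definition sub_tangent S x : set 'rV[R]_n :=
  [set v | exists gam, sub_curve S x v gam].

Definition sub_smooth_at {W : normedModType R} S (F : 'rV[R]_n -> W) x : Prop :=
  exists2 G : 'rV[R]_n -> W, smooth_at G x & \forall y \near x, S y -> F y = G y.

Definition sub_field_at S (X : 'rV[R]_n -> 'rV[R]_n) x : Prop :=
  (\forall y \near x, S y -> sub_tangent S y (X y)) /\ sub_smooth_at S X x.

End Submanifold.

(** A tangent vector at [q] is the operator F |-> (F o gam)'(0) on the functions
    smooth near [q]; it is extended by 0 to the other functions, so that equality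
    and linear combinations of tangent vectors are those of functionals. *)
Notation tvec R T := ((T -> R) -> R^o).

(** Abstract manifolds are carried by a subset [X] of an arbitrary type [T].
    [chart_inv] is only meaningful on the image of [chart_dom]. *)
Record chart (R : realType) (T : Type) (d : nat) := Chart {
  chart_dom : set T;
  chart_map : T -> 'rV[R]_d;
  chart_inv : 'rV[R]_d -> T }.

Section Manifold.
Context {R : realType} {T : Type} {d : nat}.
Variable A : set (chart R T d).

Definition is_atlas (X : set T) : Prop :=
  [/\ forall c, A c -> chart_dom c `<=` X,
      forall q, X q -> exists2 c, A c & chart_dom c q,
      forall c q, A c -> chart_dom c q -> chart_inv c (chart_map c q) = q,
      forall c, A c -> open (chart_map c @` chart_dom c) &
      forall c1 c2, A c1 -> A c2 ->
        let U := chart_map c1 @` (chart_dom c1 `&` chart_dom c2) in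
        open U /\ smooth_on U (chart_map c2 \o chart_inv c1)].

Definition man_open (X O : set T) : Prop :=
  O `<=` X /\ forall c, A c -> open (chart_map c @` (O `&` chart_dom c)).

Definition is_manifold (X : set T) : Prop :=
  [/\ is_atlas X,
      forall q1 q2, X q1 -> X q2 -> q1 <> q2 ->
        exists O1 O2, [/\ man_open X O1, man_open X O2, O1 q1, O2 q2 &
                          O1 `&` O2 = set0] &
      exists B : nat -> set T, (forall i, man_open X (B i)) /\
        forall O q, man_open X O -> O q -> exists2 i, B i q & B i `<=` O].

Definition man_smooth_at (F : T -> R) (q : T) : Prop :=
  exists c, [/\ A c, chart_dom c q &
    smooth_at (F \o chart_inv c : 'rV[R]_d -> R^o) (chart_map c q)].

Definition man_curve (q : T) (gam : R -> T) : Prop :=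
  gam 0 = q /\
  exists c, [/\ A c, \forall t \near (0 : R), chart_dom c (gam t) &
    smooth_at (chart_map c \o gam : R^o -> 'rV[R]_d) 0].

Definition velocity (q : T) (gam : R -> T) : tvec R T :=
  fun F => if `[< man_smooth_at F q >]
           then derive1 (F \o gam : R -> R^o) 0 else 0.

Definition man_tangent (q : T) : set (tvec R T) :=
  [set u | exists2 gam, man_curve q gam & u = velocity q gam].

Definition man_field_at (X : set T) (Y : T -> tvec R T) (q : T) : Prop :=
  exists O, [/\ man_open X O, O q & forall q', O q' ->
    man_tangent q' (Y q') /\
    forall F, man_smooth_at F q' -> man_smooth_at (fun z => Y z F) q'].

Definition man_local_min (X : set T) (F : T -> R) (q : T) : Prop :=
  exists O, [/\ man_open X O, O q & forall q', O q' -> F q <= F q'].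

Definition isolated_minima (X : set T) (F : T -> R) : Prop :=
  forall q, man_local_min X F q ->
    exists O, [/\ man_open X O, O q &
                  forall q', O q' -> man_local_min X F q' -> q' = q].

End Manifold.

(** Inner products on the tangent spaces, depending smoothly on the point:
    applied below both to a submanifold of R^n and to an abstract manifold. *)
Definition riemannian_metric {R : realType} {T : Type} {V : lmodType R}
    (X : set T) (tangent : T -> set V) (smooth : (T -> R) -> T -> Prop)
    (field : (T -> V) -> T -> Prop) (g : T -> V -> V -> R) : Prop :=
  forall q, X q ->
  [/\ forall (a : R) (u v w : V),
        tangent q u -> tangent q v -> tangent q w ->
        g q (a *: u + v) w = a * g q u w + g q v w,
      forall u v, tangent q u -> tangent q v -> g q u v = g q v u,
      forall u, tangent q u -> u <> 0 -> 0 < g q u u &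
      forall Y Z, field Y q -> field Z q -> smooth (fun z => g z (Y z) (Z z)) q].

Section RiemannianManifold.
Context {R : realType} {T : Type} {d : nat}.
Variables (A : set (chart R T d)) (X : set T).
Local Notation tangent := (man_tangent A).
Local Notation field := (man_field_at A X).
Local Notation smooth := (man_smooth_at A).

Definition man_metric (g : T -> tvec R T -> tvec R T -> R) : Prop :=
  riemannian_metric X tangent smooth field g.

Variable g : T -> tvec R T -> tvec R T -> R.

Definition is_gradient (F : T -> R) (G : T -> tvec R T) : Prop :=
  forall q, X q -> field G q /\ forall u, tangent q u -> g q (G q) u = u F.

(** Affine connections are local operators, so that [nabla] is taken on fields
    defined near a point; [levi_civita] determines it uniquely on those fields.
    [nabla q u Y] is the derivative of the field [Y], smooth near [q], in the
    direction of the tangent vector [u] at [q]. *)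
Record levi_civita (nabla : T -> tvec R T -> (T -> tvec R T) -> tvec R T) :
    Prop := {
  lc_tangent : forall q u Y, X q -> tangent q u -> field Y q ->
    tangent q (nabla q u Y);
  lc_smooth : forall q Y Z, X q -> field Y q -> field Z q ->
    field (fun z => nabla z (Y z) Z) q;
  lc_linear_dir : forall q (a : R) u v Y, X q ->
    tangent q u -> tangent q v -> field Y q ->
    nabla q (a *: u + v) Y = a *: nabla q u Y + nabla q v Y;
  lc_linear_field : forall q u (a : R) Y Z, X q ->
    tangent q u -> field Y q -> field Z q ->
    nabla q u (fun z => a *: Y z + Z z) = a *: nabla q u Y + nabla q u Z;
  lc_leibniz : forall q u F Y, X q ->
    tangent q u -> smooth F q -> field Y q ->
    nabla q u (fun z => F z *: Y z) = u F *: Y q + F q *: nabla q u Y;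
  lc_metric : forall q u Y Z, X q ->
    tangent q u -> field Y q -> field Z q ->
    u (fun z => g z (Y z) (Z z)) =
    g q (nabla q u Y) (Z q) + g q (Y q) (nabla q u Z);
  lc_torsion_free : forall q Y Z F, X q ->
    field Y q -> field Z q -> smooth F q ->
    nabla q (Y q) Z F - nabla q (Z q) Y F =
    Y q (fun z => Z z F) - Z q (fun z => Y z F) }.

End RiemannianManifold.

Definition sub_metric {R : realType} {n : nat} (S : set 'rV[R]_n)
    (g : 'rV[R]_n -> 'rV[R]_n -> 'rV[R]_n -> R) : Prop :=
  riemannian_metric S (sub_tangent S)
    (fun F => sub_smooth_at S (F : 'rV[R]_n -> R^o)) (sub_field_at S) g.

Section Quotient.
Context {R : realType} {n : nat}.
Variables (M : set 'rV[R]_n) (sim : 'rV[R]_n -> 'rV[R]_n -> Prop).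
Local Notation point := (set 'rV[R]_n).

Definition equivalence_on : Prop :=
  [/\ forall x, M x -> sim x x,
      forall x y, M x -> M y -> sim x y -> sim y x &
      forall x y z, M x -> M y -> M z -> sim x y -> sim y z -> sim x z].

(** The canonical projection; it also names the class [x] as a subset of R^n. *)
Definition qproj (x : 'rV[R]_n) : point := [set y | M y /\ sim y x].

Definition quotient_set : set point := qproj @` M.

(** The choice of a representative is immaterial when [f] is constant on the
    equivalence classes. *)
Definition quotient_fun (f : 'rV[R]_n -> R) (q : point) : R := f (xget 0 q).

Context {d : nat}.
Variable A : set (chart R point d).

(** D pi(x)[v]; the value does not depend on the chosen curve when [qproj] is
    smooth on [M]. *)
Definition Dproj (x v : 'rV[R]_n) : tvec R point :=
  velocity A (qproj x) (qproj \o xget (cst x) [set gam | sub_curve M x v gam]).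

Definition proj_smooth : Prop :=
  forall x, M x -> exists c, [/\ A c,
    \forall y \near x, M y -> chart_dom c (qproj y) &
    sub_smooth_at M (chart_map c \o qproj) x].

Definition proj_submersion : Prop :=
  proj_smooth /\
  forall x, M x -> forall u, man_tangent A (qproj x) u ->
    exists2 v, sub_tangent M x v & Dproj x v = u.

Definition quotient_manifold : Prop :=
  is_manifold A quotient_set /\ proj_submersion.

Definition vertical (x : 'rV[R]_n) : set 'rV[R]_n := sub_tangent (qproj x) x.

Definition horizontal (x : 'rV[R]_n) (H : {vspace 'rV[R]_n}) : Prop :=
  [/\ forall v, v \in H -> sub_tangent M x v,
      forall v, vertical x v -> v \in H -> v = 0 &
      forall w, sub_tangent M x w ->
        exists u v, [/\ vertical x u, v \in H & w = u + v]].

Definition riemannian_quotient (gbar : 'rV[R]_n -> 'rV[R]_n -> 'rV[R]_n -> R)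
    (g : point -> tvec R point -> tvec R point -> R) : Prop :=
  let orth x u := forall w, vertical x w -> gbar x u w = 0 in
  forall x u v, M x -> sub_tangent M x u -> sub_tangent M x v ->
    orth x u -> orth x v ->
    g (qproj x) (Dproj x u) (Dproj x v) = gbar x u v.

End Quotient.

(* Main.v *)
(** Along a curve in M the term <lambda, h> of the Lagrangian vanishes, and
    L(., lambda) is critical at xs for the least-squares multiplier; hence
    D^2 L(v, v) is the second derivative at 0 of f along any curve of M leaving
    xs with velocity v.  Along a curve in an equivalence class f is constant,
    which gives (i).  For (ii), project the curve to the quotient: by the inverse
    function theorem the submersion pi has a smooth local section, so the induced
    function F is smooth, [xs] is a critical point of F, and in a chart the
    second derivative of F along the projected curve is the value of the second
    derivative form at the velocity.  Metric compatibility of the connection,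
    applied to grad F and to a field with constant components in the chart,
    identifies that value with the Riemannian Hessian.  That L(., lambda) is
    critical is proved by penalization, which avoids the implicit function
    theorem for h. *)

Require Import Defs.
From HB Require Import structures.
From mathcomp Require Import all_boot all_order all_algebra.
From mathcomp Require Import all_classical all_reals all_analysis.
From mathcomp Require Import ring lra.

Set Implicit Arguments.
Unset Strict Implicit.
Unset Printing Implicit Defensive.

Import Order.TTheory GRing.Theory Num.Theory.
Import numFieldNormedType.Exports.

Local Open Scope classical_set_scope.
Local Open Scope ring_scope.

(** * C^k calculus *)

Lemma differentiable_expansion (R : realType) (V W : normedModType R)
    (F : V -> W) (x : V) :
  differentiable F x -> forall e : R, 0 < e ->
  \forall k \near (0 : V), `|F (k + x) - (F x + 'd F x k)| <= e * `|k|.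
Proof.
move=> dF e e0; have /eqaddoP/(_ e e0) := diff_locally dF.
by apply: filterS => k; rewrite !fctE.
Qed.

(** A continuous linear map satisfying the first-order expansion is the differential, by uniqueness.
    This serves where a candidate derivative is known in advance, as for a right inverse. *)
Lemma expansion_differentiable (R : realType) (V W : normedModType R)
    (F : V -> W) (L : {linear V -> W}) (x : V) :
  continuous L ->
  (forall e : R, 0 < e ->
    \forall k \near (0 : V), `|F (k + x) - (F x + L k)| <= e * `|k|) ->
  differentiable F x /\ 'd F x = L :> (V -> W).
Proof.
move=> cL HL.
have FE : F \o shift x = cst (F x) + L +o_ 0 id.
  apply/eqaddoP => e e0; have := HL e e0.
  by apply: filterS => k; rewrite !fctE.
have dE := diff_unique cL FE.
by split => //; apply/diff_locallyP; rewrite dE.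
Qed.

Lemma near_eq_differentiable (R : realType) (V W : normedModType R)
    (F G : V -> W) (x : V) :
  (\near x, F x = G x) -> differentiable F x -> differentiable G x.
Proof.
move=> FG dF.
have [] // := @expansion_differentiable R V W G ('d F x) x (diff_continuous dF).
move=> e /(differentiable_expansion dF).
have FG0 : \forall k \near 0, F (k + x) = G (k + x).
  by move: FG; rewrite (near_shift 0 x) subr0.
by apply: filterS2 FG0 => k <-; rewrite (nbhs_singleton FG).
Qed.

Section Ck.
Context {R : realType}.
Implicit Types V W : normedModType R.

Lemma Ck_continuous V W k (U : set V) (F : V -> W) :
  Ck k U F -> forall x, U x -> {for x, continuous F}.
Proof.
case: k => [//|k] [dF _] x Ux.
exact/differentiable_continuous/dF.
Qed.

Lemma CkW V W k (U : set V) (F : V -> W) : Ck k.+1 U F -> Ck k U F.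
Proof.
elim: k F => [|k IH] F; first exact: Ck_continuous.
by move=> [dF DF]; split => // v; exact/IH/DF.
Qed.

Lemma Ck_subset V W k (U U' : set V) (F : V -> W) :
  U' `<=` U -> Ck k U F -> Ck k U' F.
Proof.
move=> sU; elim: k F => [|k IH] F /=; first by move=> cF x /sU; exact: cF.
by move=> [dF DF]; split => [x /sU|v]; [exact: dF | exact/IH/DF].
Qed.

(** Openness of [U] turns equality on [U] into equality near each of its points, which is what
    derivatives see. *)
Lemma Ck_eq V W k (U : set V) (F G : V -> W) :
  open U -> {in U, F =1 G} -> Ck k U F -> Ck k U G.
Proof.
move=> oU; elim: k F G => [|k IH] F G FG /=.
  move=> cF x Ux; have FGx : \near x, F x = G x.
    by near=> y; apply: FG; rewrite inE; near: y; exact: open_nbhs_nbhs.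
  rewrite /prop_for /continuous_at -(nbhs_singleton FGx).
  exact: (cvg_trans (near_eq_cvg FGx) (cF x Ux)).
have FGx x : U x -> \near x, F x = G x.
  by move=> Ux; near=> y; apply: FG; rewrite inE; near: y; exact: open_nbhs_nbhs.
move=> [dF DF]; split=> [x Ux|v].
  exact: near_eq_differentiable (FGx x Ux) (dF x Ux).
apply: IH (DF v) => x; rewrite inE => Ux.
exact: near_eq_derive (FGx x Ux).
Unshelve. all: by end_near. Qed.

Lemma Ck_cst V W k (U : set V) (w : W) : Ck k U (fun=> w).
Proof.
elim: k w => [|k IH] w /=; first by move=> x _; exact: cst_continuous.
split=> [x _|v]; first exact: differentiable_cst.
have -> : (fun x => 'D_v (fun=> w) x) = (fun=> 0) :> (V -> W).
  by apply/funext => x; exact: derive_cst.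
exact: IH.
Qed.

(** The derivative of [L \o F] is [L] composed with that of [F], so the induction on [k] reproduces
    its own statement. *)
Lemma Ck_linear V V' W k (U : set V) (L : {linear V' -> W}) (F : V -> V') :
  continuous L -> open U -> Ck k U F -> Ck k U (L \o F).
Proof.
move=> cL oU; elim: k F => [|k IH] F /=.
  by move=> cF x Ux; apply: continuous_comp; [exact: cF | exact: cL].
move=> [dF DF]; split=> [x Ux|v].
  by apply: differentiable_comp; [exact: dF | exact: linear_differentiable].
apply: (Ck_eq oU _ (IH _ (DF v))) => x; rewrite inE => Ux /=.
rewrite [RHS]deriveE; last first.
  by apply: differentiable_comp; [exact: dF | exact: linear_differentiable].
rewrite diff_comp; [|exact: dF|exact: linear_differentiable].
by rewrite /= diff_lin // deriveE //; exact: dF.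
Qed.

Lemma CkD V W k (U : set V) (F G : V -> W) :
  open U -> Ck k U F -> Ck k U G -> Ck k U (fun x => F x + G x).
Proof.
move=> oU; elim: k F G => [|k IH] F G /=.
  by move=> cF cG x Ux; apply: continuousD; [exact: cF | exact: cG].
move=> [dF DF] [dG DG]; split=> [x Ux|v].
  by apply: differentiableD; [exact: dF | exact: dG].
apply: (Ck_eq oU _ (IH _ _ (DF v) (DG v))) => x; rewrite inE => Ux /=.
by rewrite -deriveD //; apply: diff_derivable; [exact: dF | exact: dG].
Qed.

Lemma CkM V k (U : set V) (F G : V -> R^o) :
  open U -> Ck k U F -> Ck k U G -> Ck k U (fun x => F x * G x : R^o).
Proof.
move=> oU; elim: k F G => [|k IH] F G.
  by move=> cF cG x Ux; apply: continuousM; [exact: cF | exact: cG].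
move=> CF CG; have [dF DF] := CF; have [dG DG] := CG; split=> [x Ux|v].
  by apply: differentiableM; [exact: dF | exact: dG].
apply: (Ck_eq oU _ (CkD oU (IH _ _ (CkW CF) (DG v)) (IH _ _ (CkW CG) (DF v)))) => x.
rewrite inE => Ux /=.
by rewrite [RHS]deriveM //; apply: diff_derivable; [exact: dF | exact: dG].
Qed.

(** The derivative of 1/F is -(1/F)(1/F) DF, and the induction hypothesis already makes 1/F of class
    C^k. *)
Lemma CkV V k (U : set V) (F : V -> R^o) :
  open U -> (forall x, U x -> F x != 0) -> Ck k U F ->
  Ck k U (fun x => (F x)^-1 : R^o).
Proof.
move=> oU F0; elim: k => [|k IH].
  by move=> cF x Ux; apply: continuousV; [exact: F0 | exact: cF].
move=> CF; have [dF DF] := CF; have CV := IH (CkW CF); split=> [x Ux|v].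
  by apply: differentiableV; [exact: dF | exact: F0].
have := CkM oU (Ck_cst k U (-1 : R^o)) (CkM oU (CkM oU CV CV) (DF v)).
apply: Ck_eq => // x; rewrite inE => Ux /=.
rewrite [RHS]deriveV; [|exact: F0|exact/diff_derivable/dF].
by rewrite mulN1r scaleNr -invrM ?unitfE ?F0 //.
Qed.

Lemma Ck_sum V W k (U : set V) I (s : seq I) (P : pred I) (F : I -> V -> W) :
  open U -> (forall i, P i -> Ck k U (F i)) ->
  Ck k U (fun x => \sum_(i <- s | P i) F i x).
Proof.
move=> oU CF; elim: s => [|i s IH].
  rewrite (_ : (fun x => \sum_(j <- [::] | P j) F j x) = fun=> 0); first exact: Ck_cst.
  by apply/funext => x; rewrite big_nil.
rewrite (_ : (fun x => \sum_(j <- i :: s | P j) F j x) =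
    fun x => if P i then F i x + \sum_(j <- s | P j) F j x
                                     else \sum_(j <- s | P j) F j x); last first.
  by apply/funext => x; rewrite big_cons.
by case: (boolP (P i)) => // /CF Ci; exact: CkD.
Qed.

Lemma Ck_prod V k (U : set V) I (s : seq I) (P : pred I) (F : I -> V -> R^o) :
  open U -> (forall i, P i -> Ck k U (F i)) ->
  Ck k U (fun x => \prod_(i <- s | P i) F i x : R^o).
Proof.
move=> oU CF; elim: s => [|i s IH].
  rewrite (_ : (fun x => \prod_(j <- [::] | P j) F j x) = fun=> 1); first exact: Ck_cst.
  by apply/funext => x; rewrite big_nil.
rewrite (_ : (fun x => \prod_(j <- i :: s | P j) F j x) =
    fun x => if P i then F i x * \prod_(j <- s | P j) F j x
                                     else \prod_(j <- s | P j) F j x); last first.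
  by apply/funext => x; rewrite big_cons.
by case: (boolP (P i)) => // /CF Ci; exact: CkM.
Qed.

Lemma Ck_coord V k (U : set V) m n (F : V -> 'M[R]_(m, n)) i j :
  open U -> Ck k U F -> Ck k U (fun x => F x i j : R^o).
Proof.
have @f : {linear 'M[R]_(m, n) -> R^o}.
  by exists (fun N : 'M[R]_(_, _) => N i j); do 2![eexists]; do ?[constructor];
     rewrite ?mxE// => ? *; rewrite ?mxE//; move=> ?; rewrite !mxE.
by move=> oU CF; apply: (@Ck_linear _ _ _ _ _ f) => //; exact: coord_continuous.
Qed.

Lemma Ck_scalel V W k (U : set V) (F : V -> R^o) (w : W) :
  open U -> Ck k U F -> Ck k U (fun x => F x *: w).
Proof.
move=> oU CF.
have sx_lin : linear ( *:%R ^~ w : R^o -> _).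
  by move=> u y z; rewrite scalerDl scalerA.
pose sxlM := GRing.isLinear.Build _ _ _ _ _ sx_lin.
pose sxL : {linear _ -> _} := HB.pack (fun x : R^o => x *: w) sxlM.
by apply: (@Ck_linear _ _ _ _ _ sxL) => //; exact: scalel_continuous.
Qed.

Lemma Ck_rV V k (U : set V) n (F : V -> 'rV[R]_n) :
  open U -> (forall i, Ck k U (fun x => F x 0 i : R^o)) -> Ck k U F.
Proof.
move=> oU CF.
rewrite (_ : F = fun x => \sum_i F x 0 i *: delta_mx 0 i); last first.
  by apply/funext => x; rewrite -row_sum_delta.
by apply: Ck_sum => // i _; exact: Ck_scalel.
Qed.

Lemma derive_delta (W : normedModType R) n (F : 'rV[R]_n -> W) (x v : 'rV[R]_n) :
  differentiable F x -> 'D_v F x = \sum_i v 0 i *: 'D_(delta_mx 0 i) F x.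
Proof.
move=> dF; rewrite deriveE // [in LHS](row_sum_delta v) linear_sum.
by apply: eq_bigr => i _; rewrite linearZ deriveE.
Qed.

Lemma derive_comp V V' W (F : V -> V') (G : V' -> W) x v :
  differentiable F x -> differentiable G (F x) ->
  'D_v (G \o F) x = 'D_('D_v F x) G (F x).
Proof.
move=> dF dG; rewrite deriveE; last exact: differentiable_comp.
by rewrite diff_comp //= !deriveE.
Qed.

(** The chain rule differentiates [G] in a direction that varies with the point, whereas [Ck] only
    speaks of fixed directions. With R^n in the middle, that derivative is a finite sum of products
    of coordinates of ['D_v F] with partial derivatives of [G] composed with [F], to which the
    induction hypothesis applies. *)
Lemma Ck_comp V k n (U : set V) (U' : set 'rV[R]_n) (F : V -> 'rV[R]_n)
    (G : 'rV[R]_n -> R^o) :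
  open U -> (forall x, U x -> U' (F x)) -> Ck k U F -> Ck k U' G ->
  Ck k U (G \o F).
Proof.
move=> oU UU'; elim: k G => [|k IH] G.
  by move=> cF cG x Ux; apply: continuous_comp; [exact: cF|exact/cG/UU'].
move=> CF [dG DG]; have [dF DF] := CF; split=> [x Ux|v].
  by apply: differentiable_comp; [exact: dF|exact/dG/UU'].
apply: (@Ck_eq _ _ _ _ (fun x => \sum_i ('D_v F x) 0 i * 'D_(delta_mx 0 i) G (F x) : R^o)) => //.
  move=> x; rewrite inE => Ux; rewrite [RHS]derive_comp; [|exact: dF|exact/dG/UU'].
  by rewrite derive_delta //; exact/dG/UU'.
apply: Ck_sum => // i _; apply: CkM => //; first exact: (Ck_coord _ _ oU (DF v)).
exact: IH (CkW CF) (DG _).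
Qed.

Lemma Ck_det V k n (U : set V) (F : V -> 'M[R]_n) :
  open U -> (forall i j, Ck k U (fun x => F x i j : R^o)) ->
  Ck k U (fun x => \det (F x) : R^o).
Proof.
move=> oU CF; apply: Ck_sum => // s _; apply: CkM => //; first exact: Ck_cst.
by apply: Ck_prod => // i _; exact: CF.
Qed.

Lemma Ck_adj V k n (U : set V) (F : V -> 'M[R]_n) i j :
  open U -> (forall i j, Ck k U (fun x => F x i j : R^o)) ->
  Ck k U (fun x => (\adj (F x)) i j : R^o).
Proof.
move=> oU CF; under eq_fun do rewrite mxE.
apply: CkM => //; first exact: Ck_cst.
apply: Ck_det => // i' j'; under eq_fun do rewrite !mxE; exact: CF.
Qed.

End Ck.

(** * Smoothness at a point *)

Section SmoothAt.
Context {R : realType}.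
Implicit Types V W : normedModType R.

Lemma smooth_at_near V W (F : V -> W) x :
  smooth_at F x -> \forall y \near x, smooth_at F y.
Proof.
move=> [U [oU Ux sF]]; have : nbhs x U by exact: open_nbhs_nbhs.
by apply: filterS => y Uy; exists U.
Qed.

Lemma smooth_at_differentiable V W (F : V -> W) x :
  smooth_at F x -> differentiable F x.
Proof. by move=> [U [oU Ux /(_ 1%N)[dF _]]]; exact: dF. Qed.

Lemma smooth_at_continuous V W (F : V -> W) x :
  smooth_at F x -> {for x, continuous F}.
Proof. by move=> /smooth_at_differentiable/differentiable_continuous. Qed.

Lemma smooth_at_eq V W (F G : V -> W) x :
  (\forall y \near x, F y = G y) -> smooth_at F x -> smooth_at G x.
Proof.
move=> FG [U [oU Ux sF]].
have := FG; rewrite -nbhs_nearE nbhsE => -[Q [oQ Qx] FGQ].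
exists (U `&` Q); split => //; first exact: openI.
move=> k; apply: (@Ck_eq _ _ _ _ _ F); first exact: openI.
  by move=> y; rewrite inE => -[_ Qy]; exact: FGQ.
by apply: Ck_subset (sF k) => y [].
Qed.

Lemma smooth_at_derive V W (F : V -> W) x v :
  smooth_at F x -> smooth_at ('D_v F) x.
Proof.
move=> [U [oU Ux sF]]; exists U; split => // k.
by have [_] := sF k.+1; exact.
Qed.

Lemma smooth_at_cst V W (w : W) (x : V) : smooth_at (fun=> w) x.
Proof. by exists setT; split => //; [exact: openT|move=> k; exact: Ck_cst]. Qed.

Lemma smooth_at_linear V V' W (L : {linear V' -> W}) (F : V -> V') x :
  continuous L -> smooth_at F x -> smooth_at (L \o F) x.
Proof.
move=> cL [U [oU Ux sF]]; exists U; split => // k.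
exact: Ck_linear.
Qed.

Lemma smooth_at_id V (x : V) : smooth_at id x.
Proof.
exists setT; split => //; first exact: openT.
elim=> [|k IH]; first by move=> y _; exact: cvg_id.
split=> [y _//|v]; rewrite (_ : (fun _ => _) = fun=> v); first exact: Ck_cst.
by apply/funext => y; rewrite derive_id.
Qed.

(** Transfers a binary rule for [Ck] to [smooth_at], by intersecting the two open domains. *)
Lemma smooth_at2 V W W' W'' (F : V -> W) (G : V -> W') (H : V -> W'') x :
  (forall k U, open U -> Ck k U F -> Ck k U G -> Ck k U H) ->
  smooth_at F x -> smooth_at G x -> smooth_at H x.
Proof.
move=> FGH [U [oU Ux sF]] [U' [oU' Ux' sG]].
exists (U `&` U'); split => //; first exact: openI.
move=> k; apply: FGH; first exact: openI.
- by apply: Ck_subset (sF k) => y [].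
- by apply: Ck_subset (sG k) => y [].
Qed.

Lemma smooth_atD V W (F G : V -> W) x :
  smooth_at F x -> smooth_at G x -> smooth_at (fun y => F y + G y) x.
Proof. by apply: smooth_at2 => k U; exact: CkD. Qed.

Lemma smooth_atM V (F G : V -> R^o) x :
  smooth_at F x -> smooth_at G x -> smooth_at (fun y => F y * G y : R^o) x.
Proof. by apply: smooth_at2 => k U; exact: CkM. Qed.

Lemma smooth_at_sum V W I (s : seq I) (F : I -> V -> W) x :
  (forall i, smooth_at (F i) x) -> smooth_at (fun y => \sum_(i <- s) F i y) x.
Proof.
move=> sF; elim: s => [|i s IH].
  rewrite (_ : (fun y => \sum_(j <- [::]) F j y) = fun=> 0); first exact: smooth_at_cst.
  by apply/funext => y; rewrite big_nil.
rewrite (_ : (fun y => \sum_(j <- i :: s) F j y) =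
    fun y => F i y + \sum_(j <- s) F j y); first exact: smooth_atD.
by apply/funext => y; rewrite big_cons.
Qed.

Lemma smooth_at_coord V m n (F : V -> 'M[R]_(m, n)) i j x :
  smooth_at F x -> smooth_at (fun y => F y i j : R^o) x.
Proof.
by move=> [U [oU Ux sF]]; exists U; split => // k; exact: Ck_coord.
Qed.

Lemma smooth_at_scalel V W (F : V -> R^o) (w : W) x :
  smooth_at F x -> smooth_at (fun y => F y *: w) x.
Proof.
by move=> [U [oU Ux sF]]; exists U; split => // k; exact: Ck_scalel.
Qed.

Lemma smooth_at_rV V n (F : V -> 'rV[R]_n) x :
  (forall i, smooth_at (fun y => F y 0 i : R^o) x) -> smooth_at F x.
Proof.
move=> sF; rewrite (_ : F = fun y => \sum_i F y 0 i *: delta_mx 0 i); last first.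
  by apply/funext => y; rewrite -row_sum_delta.
by apply: smooth_at_sum => i; exact: smooth_at_scalel.
Qed.

Lemma smooth_at_comp V n (F : V -> 'rV[R]_n) (G : 'rV[R]_n -> R^o) x :
  smooth_at F x -> smooth_at G (F x) -> smooth_at (G \o F) x.
Proof.
move=> [U [oU Ux sF]] [U' [oU' Ux' sG]].
have oUU' : open (U `&` F @^-1` U').
  rewrite openE => y [Uy U'Fy]; apply: filterI; first exact: open_nbhs_nbhs.
  by apply: (Ck_continuous (sF 0%N)) => //; exact: open_nbhs_nbhs.
exists (U `&` F @^-1` U'); split => // k.
apply: (Ck_comp (U' := U')) => //; first by move=> y [].
by apply: Ck_subset (sF k) => y [].
Qed.

Lemma smooth_at_comp_rV V n m (F : V -> 'rV[R]_n) (G : 'rV[R]_n -> 'rV[R]_m) x :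
  smooth_at F x -> smooth_at G (F x) -> smooth_at (G \o F) x.
Proof.
move=> sF sG; apply: smooth_at_rV => i.
exact: (smooth_at_comp (G := fun y => G y 0 i) sF (smooth_at_coord _ _ sG)).
Qed.

End SmoothAt.

(** * Inverse function theorem *)

Section InverseFunction.
Context {R : realType}.

Lemma mx_norm_le m n (x : 'M[R]_(m, n)) c :
  0 <= c -> (forall i j, `|x i j| <= c) -> `|x| <= c.
Proof.
move=> c0 xc; rewrite /Num.Def.normr /= mx_normrE bigmax_le // => -[i j] _; exact: xc.
Qed.

Lemma le_mx_norm m n (x : 'M[R]_(m, n)) i j : `|x i j| <= `|x|.
Proof.
rewrite [leRHS]/Num.Def.normr /= mx_normrE.
exact: (le_bigmax _ (fun ij : 'I_m * 'I_n => `|x ij.1 ij.2|) (i, j)).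
Qed.

Lemma derive_coord (V : normedModType R) m n (F : V -> 'M[R]_(m, n)) x v i j :
  derivable F x v -> 'D_v (fun y => F y i j : R^o) x = ('D_v F x) i j.
Proof. by move=> dF; rewrite derive_mx // mxE. Qed.

Lemma is_derive_line (V : normedModType R) (a w : V) (t : R^o) :
  is_derive t (1 : R^o) (fun s : R^o => a + s *: w) w.
Proof.
have dl : is_diff t (fun s : R^o => a + s *: w) (fun s : R^o => s *: w).
  apply: (@is_diff_eq _ _ _ _ (0 + ( *:%R^~ w))).
  by apply/funext => s; rewrite /= add0r.
apply: DeriveDef; first exact/diff_derivable/ex_diff.
by rewrite deriveE ?diff_val ?scale1r //; exact: ex_diff.
Qed.

(* The mean value inequality, coordinate by coordinate since the norm is the
   sup norm. *)
Lemma lipschitz_derive m n (F : 'rV[R]_m -> 'rV[R]_n) (B : set 'rV[R]_m) (c : R) :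
  (forall x y (t : R), B x -> B y -> 0 <= t <= 1 -> B (x + t *: (y - x))) ->
  (forall x, B x -> differentiable F x) ->
  0 <= c -> (forall x v, B x -> `|'D_v F x| <= c * `|v|) ->
  forall x y, B x -> B y -> `|F y - F x| <= c * `|y - x|.
Proof.
move=> cvxB dF c0 bF x y Bx By.
apply: mx_norm_le => [|i j]; first by rewrite mulr_ge0.
pose l (t : R^o) := x + t *: (y - x).
have Bl (t : R) : 0 <= t <= 1 -> B (l t) by exact: cvxB.
pose phi (t : R^o) : R^o := F (l t) i j.
have dl (t : R^o) : differentiable l t.
  by apply/derivable1_diffP; have [] := is_derive_line x (y - x) t.
have dphi (t : R^o) : 0 <= t <= 1 -> is_derive t (1 : R^o) phi (('D_(y - x) F (l t)) i j).
  move=> t01; have dFl := dF _ (Bl _ t01).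
  have dFij : differentiable (fun z => F z i j : R^o) (l t).
    by apply: (differentiable_comp (g := fun N : 'rV[R]_n => N i j : R^o)) => //;
       exact: differentiable_coord.
  apply: DeriveDef.
    apply: diff_derivable.
    exact: (differentiable_comp (g := fun z => F z i j : R^o)).
  rewrite (derive_comp (G := fun z => F z i j : R^o)) //.
  have [_ ->] := is_derive_line x (y - x) t.
  by rewrite derive_coord //; exact: diff_derivable.
have [t t01 Et] : exists2 t, t \in `]0, 1[%R &
    phi 1 - phi 0 = ('D_(y - x) F (l t)) i j * (1 - 0).
  apply: MVT; first exact: ltr01.
    by move=> t; rewrite in_itv /= => /andP[t0 t1]; apply: dphi; rewrite !ltW.
  apply: derivable_within_continuous => t; rewrite in_itv /= => t01.
  by have [] := dphi _ t01.
move: Et; rewrite subr0 mulr1 /phi /l scale1r scale0r addr0 subrKC => Et.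
rewrite !mxE Et; apply: le_trans (le_mx_norm _ _ _) (bF _ _ _).
by apply: Bl; move: t01; rewrite in_itv /= => /andP[t0 t1]; rewrite !ltW.
Qed.

Lemma ball_convex (V : normedModType R) (a x y : V) e t :
  `|x - a| <= e -> `|y - a| <= e -> 0 <= t <= 1 ->
  `|x + t *: (y - x) - a| <= e.
Proof.
move=> xe ye /andP[t0 t1].
have -> : x + t *: (y - x) - a = (1 - t) *: (x - a) + t *: (y - a).
  rewrite scalerBl scale1r -[RHS]addrA [- _ + _]addrC -scalerBr.
  by rewrite opprB addrA subrK addrAC.
apply: le_trans (ler_normD _ _) _; rewrite !normrZ ger0_norm ?subr_ge0 // ger0_norm //.
have -> : e = (1 - t) * e + t * e by rewrite -mulrDl subrK mul1r.
by apply: lerD; apply: ler_wpM2l => //; rewrite subr_ge0.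
Qed.

(** By continuity of the partial derivatives. Together with the mean value inequality, the bound
    makes K - id a contraction of factor 1/2 on the ball. *)
Lemma derive_near_id n (K : 'rV[R]_n -> 'rV[R]_n) (U : set 'rV[R]_n) u0 :
  open U -> U u0 -> smooth_on U K -> (forall v, 'D_v K u0 = v) ->
  exists2 e : R, 0 < e & forall u, `|u - u0| <= e ->
    U u /\ forall v, `|'D_v K u - v| <= 2^-1 * `|v|.
Proof.
move=> oU Uu0 sK DK.
(* The [n] coordinate errors add up to at most n * eta * |v|, which is at most |v|/2; [n.+1] keeps
   [eta] positive for n = 0. *)
pose eta : R := (2 * n.+1%:R)^-1.
have eta0 : 0 < eta by rewrite invr_gt0 mulr_gt0.
have dK u : U u -> differentiable K u by have [dK _] := sK 1%N; exact: dK.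
have near_eta : \forall u \near u0, U u /\
    forall i, `|'D_(delta_mx 0 i) K u - delta_mx 0 i| < eta.
  suff H : \forall u \near u0,
      forall i, `|'D_(delta_mx 0 i) K u - delta_mx 0 i| < eta.
    have Un : nbhs u0 U by exact: open_nbhs_nbhs.
    by apply: filterS2 Un H.
  apply: (@filter_forall _ _
    (fun i u => `|'D_(delta_mx 0 i) K u - delta_mx 0 i| < eta) (nbhs u0)) => i.
  have [_ DKi] := sK 1%N.
  have /cvgrPdist_lt/(_ _ eta0) := DKi (delta_mx 0 i) u0 Uu0; rewrite DK.
  by apply: filterS => u; rewrite distrC.
have /nbhs_normP[e /= e0 He] := near_eta.
(* Halving fits the closed ball of the statement into the open ball just obtained. *)
exists (e / 2); first by rewrite divr_gt0.
move=> u ue; have [Uu Pu] : U u /\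
    forall i, `|'D_(delta_mx 0 i) K u - delta_mx 0 i| < eta.
  apply: He; rewrite /= distrC (le_lt_trans ue) // ltr_pdivrMr // ltr_pMr //.
  by rewrite ltr1n.
split => // v; rewrite derive_delta; last exact: dK.
rewrite {2}(row_sum_delta v) -sumrB.
apply: le_trans (ler_norm_sum _ _ _) _.
apply: (@le_trans _ _ (\sum_(i < n) `|v| * eta)).
  apply: ler_sum => i _; rewrite -scalerBr normrZ ler_pM ?normr_ge0 //.
    exact: le_mx_norm.
  exact/ltW/Pu.
rewrite sumr_const card_ord -[leLHS]mulr_natr -mulrA [leRHS]mulrC ler_wpM2l //.
rewrite /eta invfM -mulrA ler_piMr ?invr_ge0 //.
by rewrite mulrC ler_pdivrMr // mul1r ler_nat.
Qed.

Definition rV_complete n : completeNormedModType R := HB.pack 'rV[R]_n.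

Lemma rV_fixed_point n (T : 'rV[R]_n -> 'rV[R]_n) u0 e :
  0 <= e -> (forall u, `|u - u0| <= e -> `|T u - u0| <= e) ->
  (forall u v, `|u - u0| <= e -> `|v - u0| <= e -> `|T u - T v| <= 2^-1 * `|u - v|) ->
  exists2 u, `|u - u0| <= e & T u = u.
Proof.
move=> e0 TB lipT.
pose B : set (rV_complete n) := closed_ball_ Num.Def.normr (u0 : rV_complete n) e.
have BE u : B u <-> `|u - u0| <= e by rewrite /B /closed_ball_ /= distrC.
have TBB : set_fun B B T by move=> u /BE /TB /BE.
pose TF : {fun B >-> B} := HB.pack (T : rV_complete n -> rV_complete n) (isFun.Build _ _ B B T TBB).
have [] := @banach_fixed_point _ (rV_complete n) B TF.
- exists 2^-1%:nng; split; first by rewrite /= invf_lt1 ?ltr1n.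
  by move=> [u v] [/BE Bu /BE Bv]; exact: lipT.
- exact: closed_closed_ball_.
- by exists u0; apply/BE; rewrite subrr normr0.
- by move=> u /BE Bu Tu; exists u.
Qed.

(** A vector [v] of the left kernel would satisfy |v| <= |v|/2, hence vanish. *)
Lemma det_neq0_coercive n (M : 'M[R]_n) :
  (forall v : 'rV[R]_n, `|v *m M - v| <= 2^-1 * `|v|) -> \det M != 0.
Proof.
move=> HM; rewrite -unitfE -unitmxE -row_free_unit -kermx_eq0; apply/rowV0P => v /sub_kermxP vM.
apply/eqP; rewrite -normr_le0; have := HM v; rewrite vM sub0r normrN.
by rewrite -subr_le0 -[X in X - _]mul1r -mulrBl pmulr_rle0 // subr_gt0 invf_lt1 ?ltr1n.
Qed.

Lemma rV_linear_continuous m n (L : {linear 'rV[R]_m -> 'rV[R]_n}) : continuous L.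
Proof.
rewrite (_ : (L : _ -> _) = fun v => \sum_i v 0 i *: L (delta_mx 0 i)); last first.
  apply/funext => v; rewrite [in LHS](row_sum_delta v) linear_sum.
  by apply: eq_bigr => i _; rewrite linearZ.
move=> v; apply: (@Ck_continuous _ _ _ 0%N setT) => //.
apply: (@Ck_sum _ _ _ 0%N setT _ _ xpredT
  (fun i (v : 'rV[R]_m) => v 0 i *: L (delta_mx 0 i)) openT) => i _.
apply: (@Ck_scalel _ _ _ 0%N setT (fun v : 'rV[R]_m => v 0 i) _ openT).
by move=> x _; exact: coord_continuous.
Qed.

(* If s inverts K on the right, s(y + k) - s(y) solves
   w J = k - o(w), so that being Lipschitz makes it equal to k J^-1 + o(k). *)
Lemma differentiable_right_inverse n (K s : 'rV[R]_n -> 'rV[R]_n) y (c : R) :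
  differentiable K (s y) -> 'J K (s y) \in unitmx -> 0 < c ->
  (\forall z \near y, K (s z) = z) ->
  (\forall z \near y, `|s z - s y| <= c * `|z - y|) ->
  differentiable s y /\ forall v, 'D_v s y = v *m invmx ('J K (s y)).
Proof.
move=> dK Ju c0 Ks lip; set J := 'J K (s y) in Ju *.
pose L : {linear 'rV[R]_n -> 'rV[R]_n} := mulmxr (invmx J).
have cL : continuous L by exact: rV_linear_continuous.
have [l l0 Ll] := linear_lipschitz cL.
have [|ds dE] := @expansion_differentiable R _ _ s L y cL; last first.
  by split => // v; rewrite deriveE // dE.
move=> eps eps0.
(* With this tolerance the expansion error of [K] at the increment [w] of [s] is at most eps/(l c)
   |w|. Since |w| <= c |k| and [L] has Lipschitz constant [l], the final error is at most eps
   |k|. *)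
have dpos : 0 < eps / (l * c) by rewrite divr_gt0 // mulr_gt0.
have := differentiable_expansion dK dpos.
rewrite -nbhs_nearE => /nbhs_normP[r /= r0 Kr].
have rc0 : 0 < r / c by rewrite divr_gt0.
have near_rc : \forall k \near (0 : 'rV[R]_n), `|k| < r / c by exact: nbhs0_lt.
have Ks0 : \forall k \near (0 : 'rV[R]_n), K (s (k + y)) = k + y.
  by move: Ks; rewrite (near_shift 0 y) subr0.
have lip0 : \forall k \near (0 : 'rV[R]_n), `|s (k + y) - s y| <= c * `|k|.
  by move: lip; rewrite (near_shift 0 y) subr0; apply: filterS => k /=; rewrite addrK.
apply: filterS3 near_rc Ks0 lip0 => k krc Kk lipk.
rewrite /=; set w := s (k + y) - s y.
have wr : `|w| < r.
  by apply: le_lt_trans lipk _; rewrite mulrC -ltr_pdivlMr.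
have := Kr w; rewrite /= sub0r normrN => /(_ wr); rewrite /w subrK Kk.
rewrite (nbhs_singleton Ks) -/w => Kw.
have -> : s (k + y) - (s y + L k) = - L (k + y - (y + 'd K (s y) w)).
  have -> : k + y - (y + 'd K (s y) w) = k - w *m J.
    by rewrite mul_rV_lin1 opprD addrA addrK.
  by rewrite linearB /= mulmxK // opprB opprD addrA.
rewrite normrN; apply: le_trans (Ll _) _.
apply: (@le_trans _ _ (l * (eps / (l * c) * (c * `|k|)))).
  rewrite ler_pM2l //; apply: le_trans Kw _.
  by rewrite ler_pM2l.
rewrite le_eqVlt; apply/orP; left; apply/eqP; field.
by rewrite !gt_eqF.
Qed.

(** The equation K u = y is the fixed point equation of u |-> y - (K u - u), a contraction near
    [u0]. Assuming the derivative at [u0] to be the identity loses nothing here, as the map to be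
    inverted can be built that way. *)
Theorem local_right_inverse n (K : 'rV[R]_n -> 'rV[R]_n) u0 :
  smooth_at K u0 -> (forall v, 'D_v K u0 = v) ->
  exists s, [/\ smooth_at s (K u0), s (K u0) = u0 &
                \forall y \near K u0, K (s y) = y].
Proof.
move=> [U [oU Uu0 sK]] DK.
have [e e0 He] := derive_near_id oU Uu0 sK DK.
pose B := [set u : 'rV[R]_n | `|u - u0| <= e].
have dK u : B u -> differentiable K u.
  by move=> /He[Uu _]; have [dK _] := sK 1%N; exact: dK.
have lipr u v : B u -> B v -> `|(K u - u) - (K v - v)| <= 2^-1 * `|u - v|.
  move=> Bu Bv; apply: (@lipschitz_derive _ _ (fun u => K u - u) B) => //.
  - by move=> x y t; exact: ball_convex.
  - by move=> x Bx; apply: differentiableB => //; exact: dK.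
  - move=> x w Bx; rewrite deriveB ?derive_id //; first by have [_] := He x Bx; exact.
    exact/diff_derivable/dK.
(* Since K - id contracts by 1/2, [K] is injective on [B], and any right inverse into [B] is
   Lipschitz of constant 2. *)
have Kinj u v : B u -> B v -> `|u - v| <= 2 * `|K u - K v|.
  move=> Bu Bv; have := lipr u v Bu Bv.
  have : `|u - v| <= `|K u - K v| + `|(K u - u) - (K v - v)|.
    have {1}-> : u - v = (K u - K v) - ((K u - u) - (K v - v)).
      by apply/rowP => i; rewrite !mxE; ring.
    exact: ler_normB.
  by lra.
(* For [y] in [V] and [u] in [B], y - (K u - u) is within e/2 + e/2 of [u0], so the iteration
   preserves [B]. *)
pose V := ball (K u0) (e / 2).
have Bu0 : B u0 by rewrite /B /= subrr normr0 ltW.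
have ex y : V y -> exists2 u, B u & K u = y.
  rewrite /V -ball_normE /= => Vy.
  have [u Bu Tu] : exists2 u, `|u - u0| <= e & y - (K u - u) = u.
    apply: rV_fixed_point; [exact: ltW| |].
      move=> u Bu; have := lipr u u0 Bu Bu0.
      have -> : y - (K u - u) - u0 = (y - K u0) - ((K u - u) - (K u0 - u0)).
        by apply/rowP => i; rewrite !mxE; ring.
      move=> lu; apply: le_trans (ler_normB _ _) _.
      by rewrite [`|y - _|]distrC; move: lu Vy Bu; lra.
    move=> u v Bu Bv; rewrite distrC.
    have -> : y - (K v - v) - (y - (K u - u)) = (K u - u) - (K v - v).
      by apply/rowP => i; rewrite !mxE; ring.
    exact: lipr.
  exists u => //; move: Tu => /eqP; rewrite opprB addrA subr_eq [u + _]addrC.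
  by move=> /eqP/addIr.
pose s y := xget u0 [set u | B u /\ K u = y].
have sP y : V y -> B (s y) /\ K (s y) = y.
  move=> /ex[u Bu Ku]; apply: (@xgetPex _ u0 [set u | B u /\ K u = y]).
  by exists u.
have oV : open V by exact: ball_open.
have VKu0 : V (K u0) by apply: ballxx; rewrite divr_gt0.
have su0 : s (K u0) = u0.
  have [Bs Ks] := sP _ VKu0; apply/eqP; rewrite -subr_eq0 -normr_le0.
  by apply: le_trans (Kinj _ _ Bs Bu0) _; rewrite Ks subrr normr0 mulr0.
pose J y := 'J K (s y).
have Ju y : V y -> \det (J y) != 0.
  move=> Vy; apply: det_neq0_coercive => v; rewrite /J.
  have [Bs _] := sP y Vy; rewrite -deriveEjacobian; last exact: dK.
  by have [_] := He _ Bs; exact.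
have ds y : V y -> differentiable s y /\ forall v, 'D_v s y = v *m invmx (J y).
  move=> Vy; have [Bs Ks] := sP _ Vy.
  apply: (@differentiable_right_inverse n K s y 2) => //.
  - exact: dK.
  - by rewrite unitmxE unitfE; exact: Ju.
  - near=> z; apply: (sP z _).2; near: z; exact: open_nbhs_nbhs.
  - near=> z; have [Bz Kz] : B (s z) /\ K (s z) = z.
      by apply: sP; near: z; exact: open_nbhs_nbhs.
    by apply: le_trans (Kinj _ _ Bz Bs) _; rewrite Kz Ks.
have sU y : V y -> U (s y) by move=> /sP[/He[]].
have JE y i j : V y -> J y i j = ('D_(delta_mx 0 i) K (s y)) 0 j.
  move=> Vy; have [Bs _] := sP y Vy.
  by rewrite (deriveE _ (dK _ Bs)) [LHS]mxE.
exists s; split => //; last first.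
  by near=> y; apply: (sP y _).2; near: y; exact: open_nbhs_nbhs.
(* Bootstrap: if [s] is C^k, so is [J], the Jacobian of [K] taken along [s]; then D_v s = v J^-1 is
   C^k by Cramer's rule, and [s] is C^(k+1). *)
exists V; split => //; elim=> [|k IH].
  by move=> y /ds[/differentiable_continuous].
split=> [y /ds[]//|v]; apply: Ck_rV => // j.
have CJ i i' : Ck k V (fun y => J y i i' : R^o).
  apply: (@Ck_eq _ _ _ _ _ (fun y => ('D_(delta_mx 0 i) K (s y)) 0 i' : R^o)) => //.
    by move=> y; rewrite inE => Vy; rewrite JE.
  apply: (Ck_comp (G := fun u => ('D_(delta_mx 0 i) K u) 0 i') oV sU IH).
  by apply: Ck_coord => //; have [_] := sK k.+1; exact.
apply: (@Ck_eq _ _ _ _ _ (fun y =>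
  \sum_i v 0 i * ((\det (J y))^-1 * (\adj (J y)) i j) : R^o)) => //.
  move=> y; rewrite inE => Vy; have [_ ->] := ds y Vy.
  rewrite mxE; apply: eq_bigr => i _.
  by rewrite /invmx unitmxE unitfE Ju // [in RHS]mxE.
apply: (@Ck_sum _ _ R^o k V _ _ xpredT
  (fun i y => v 0 i * ((\det (J y))^-1 * (\adj (J y)) i j))) => // i _.
apply: CkM => //; first exact: Ck_cst.
apply: CkM => //; last exact: Ck_adj.
by apply: CkV => //; exact: Ck_det.
Unshelve. all: by end_near. Qed.

End InverseFunction.

(** * Lagrange multipliers *)

Section Lagrange.
Context {R : realType}.

Lemma innerC k (u v : 'rV[R]_k) : inner u v = inner v u.
Proof. by apply: eq_bigr => i _; rewrite mulrC. Qed.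

Lemma inner0 k (u : 'rV[R]_k) : inner 0 u = 0.
Proof. by rewrite /inner big1 // => i _; rewrite mxE mul0r. Qed.

Lemma innerZ k a (u v : 'rV[R]_k) : inner (a *: u) v = a * inner u v.
Proof. by rewrite /inner mulr_sumr; apply: eq_bigr => i _; rewrite mxE mulrA. Qed.

Lemma inner_mulmx k (u v : 'rV[R]_k) : inner u v = (u *m v^T) 0 0.
Proof. by rewrite mxE; apply: eq_bigr => i _; rewrite mxE. Qed.

Lemma inner_ge0 k (u : 'rV[R]_k) : 0 <= inner u u.
Proof. by apply: sumr_ge0 => i _; rewrite -expr2 sqr_ge0. Qed.

Lemma inner_eq0 k (u : 'rV[R]_k) : inner u u = 0 -> u = 0.
Proof.
move=> /eqP; rewrite psumr_eq0 => [/allP u0|i _]; last by rewrite -expr2 sqr_ge0.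
apply/rowP => i; rewrite mxE; apply/eqP.
by have := u0 i (mem_index_enum i); rewrite /= mulf_eq0 orbb.
Qed.

Lemma derive_inner (V : normedModType R) k (A B : V -> 'rV[R]_k) x v :
  differentiable A x -> differentiable B x ->
  'D_v (fun y => inner (A y) (B y) : R^o) x =
  inner ('D_v A x) (B x) + inner (A x) ('D_v B x).
Proof.
move=> dA dB.
have dAi i : derivable (fun y => A y 0 i : R^o) x v.
  by apply: (iffLR (derivable_mxP A x v)); exact: diff_derivable.
have dBi i : derivable (fun y => B y 0 i : R^o) x v.
  by apply: (iffLR (derivable_mxP B x v)); exact: diff_derivable.
rewrite (_ : (fun y => inner (A y) (B y) : R^o) =
    \sum_i ((fun y => A y 0 i : R^o) * (fun y => B y 0 i : R^o))); last first.
  by apply/funext => y; rewrite fct_sumE.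
rewrite derive_sum => [|i]; last exact: derivableM.
rewrite -big_split; apply: eq_bigr => i _ /=; rewrite deriveM //.
rewrite !derive_coord; [|exact: diff_derivable..].
by rewrite addrC; congr (_ + _); rewrite [LHS]mulrC.
Qed.

Lemma differentiable_inner (V : normedModType R) k (A B : V -> 'rV[R]_k) x :
  differentiable A x -> differentiable B x ->
  differentiable (fun y => inner (A y) (B y) : R^o) x.
Proof.
have coord (C : V -> 'rV[R]_k) i : differentiable C x ->
    differentiable (fun y => C y 0 i : R^o) x.
  move=> dC; apply: (differentiable_comp (g := fun N : 'rV[R]_k => N 0 i : R^o)) => //.
  exact: differentiable_coord.
move=> dA dB; rewrite (_ : (fun y => inner (A y) (B y) : R^o) =
    \sum_i ((fun y => A y 0 i : R^o) * (fun y => B y 0 i : R^o))); last first.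
  by apply/funext => y; rewrite fct_sumE.
by apply: differentiable_sum => i; apply: differentiableM; exact: coord.
Qed.

Lemma smooth_at_inner (V : normedModType R) k (A B : V -> 'rV[R]_k) x :
  smooth_at A x -> smooth_at B x ->
  smooth_at (fun y => inner (A y) (B y) : R^o) x.
Proof.
move=> sA sB; apply: (@smooth_at_sum _ _ R^o _ _ (fun i y => A y 0 i * B y 0 i)) => i.
by apply: smooth_atM; exact: smooth_at_coord.
Qed.

(** Fermat's rule in one variable, along the line through [x] with direction [v]. *)
Lemma smooth_at_local_min n (F : 'rV[R]_n -> R^o) x v :
  smooth_at F x -> (\forall y \near x, F x <= F y) -> 'D_v F x = 0.
Proof.
move=> sF minF.
pose l (t : R^o) := x + t *: v.
have l0 : l 0 = x by rewrite /l scale0r addr0.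
have dl (t : R^o) : is_derive t (1 : R^o) l v by exact: is_derive_line.
have diffl (t : R^o) : differentiable l t.
  by apply/derivable1_diffP; have [] := dl t.
have near_l : \forall t \near (0 : R^o), smooth_at F (l t) /\ F x <= F (l t).
  have cl : {for (0 : R^o), continuous l} by exact: differentiable_continuous.
  have H : \forall y \near l 0, smooth_at F y /\ F x <= F y.
    by rewrite l0; apply: filterS2 (smooth_at_near sF) minF.
  exact: cl _ H.
have /nbhs_normP[e /= e0 He] := near_l.
have eP (t : R) : t \in `](- e), e[%R -> smooth_at F (l t) /\ F x <= F (l t).
  rewrite in_itv /= => te; apply: He; rewrite /= sub0r normrN.
  by rewrite ltr_norml.
have [||||_] := @derive1_at_min R (F \o l) (- e) e 0.
- by lra.
- move=> t /eP[sFt _]; apply/derivable1_diffP/differentiable_comp => //.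
  exact: smooth_at_differentiable.
- by rewrite in_itv /= oppr_lt0 e0.
- by move=> t /eP[_]; rewrite /= l0.
rewrite derive_comp ?l0 //; last exact: smooth_at_differentiable.
by have [_ ->] := dl 0.
Qed.

Lemma smooth_on_setT_at (V W : normedModType R) (F : V -> W) x :
  smooth_on setT F -> smooth_at F x.
Proof. by move=> sF; exists setT; split => //; exact: openT. Qed.

Lemma compact_closed_ball n (a : 'rV[R]_n) (e : R) :
  compact [set x : 'rV[R]_n | `|x - a| <= e].
Proof.
apply: bounded_closed_compact.
  exists (`|a| + e); split; first exact: num_real.
  move=> M /ltW aM x /= xe; apply: le_trans aM.
  by rewrite -[x in `|x|](subrK a) addrC (le_trans (ler_normD _ _)) // lerD2l.
have -> : [set x : 'rV[R]_n | `|x - a| <= e] = closed_ball_ Num.Def.normr a e.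
  by apply/seteqP; split => x /=; rewrite distrC.
exact: closed_closed_ball_.
Qed.

Lemma closed_le_fun (V : normedModType R) (F : V -> R) (c : R) :
  continuous F -> closed [set x | F x <= c].
Proof.
by move=> cF; apply: (@closed_comp _ _ F [set y | y <= c]) => //; exact: closed_le.
Qed.

Lemma closed_ge_dist (V : normedModType R) (a : V) (e : R) :
  closed [set x | e <= `|x - a|].
Proof.
apply: (@closed_comp _ _ (fun x : V => `|x - a|) [set y | e <= y]); last exact: closed_ge.
move=> x _; apply: cvg_norm; apply: cvgB; [exact: cvg_id|exact: cvg_cst].
Qed.

(* Minimizing f + k |h|^2 + |x - xs|^2 on a small closed ball with k large: on
   the sphere this function exceeds its value f xs at the center. *)
Lemma penalty_stationary n p (f : 'rV[R]_n -> R^o) (h : 'rV[R]_n -> 'rV[R]_p) xs :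
  smooth_on setT f -> smooth_on setT h -> h xs = 0 ->
  (\forall y \near xs, h y = 0 -> f xs <= f y) ->
  forall e : R, 0 < e -> exists x mu, `|x - xs| < e /\
    forall v, 'D_v f x + 2 * inner v (x - xs) = inner mu ('D_v h x).
Proof.
move=> sf sh hxs minf e1 e10.
have sfx x := smooth_on_setT_at x sf; have shx x := smooth_on_setT_at x sh.
have [e [e0 ee1 He]] : exists e, [/\ 0 < e, e <= e1 &
    forall y, `|y - xs| <= e -> h y = 0 -> f xs <= f y].
  have /nbhs_normP[r /= r0 Hr] := minf.
  exists (Num.min e1 (r / 2)); split; rewrite ?lt_min ?ge_min ?lexx ?e10 //.
    by rewrite divr_gt0.
  move=> y; rewrite le_min => /andP[_ yr]; apply: Hr.
  by rewrite /= distrC; lra.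
pose N (x : 'rV[R]_n) : R^o := inner (x - xs) (x - xs).
pose P (x : 'rV[R]_n) : R^o := inner (h x) (h x).
have s_id x : smooth_at (fun x : 'rV[R]_n => x - xs) x.
  by apply: smooth_atD; [exact: smooth_at_id|exact: smooth_at_cst].
have sN x : smooth_at N x by exact: smooth_at_inner.
have sP x : smooth_at P x by exact: smooth_at_inner.
pose F k (x : 'rV[R]_n) : R^o := f x + (k * P x + N x).
have sF k x : smooth_at (F k) x.
  apply: smooth_atD => //; apply: smooth_atD => //.
  by apply: smooth_atM => //; exact: smooth_at_cst.
have smooth_cont (G : 'rV[R]_n -> R^o) : (forall x, smooth_at G x) -> continuous G.
  by move=> sG x; exact: smooth_at_continuous.
have N_gt0 y : `|y - xs| = e -> 0 < N y.
  move=> ye; rewrite lt_neqAle inner_ge0 andbT eq_sym; apply/eqP => /inner_eq0 y0.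
  by move: e0; rewrite -ye y0 normr0 ltxx.
pose B := [set x : 'rV[R]_n | `|x - xs| <= e].
have cB : compact B by exact: compact_closed_ball.
have Bxs : B xs by rewrite /B /= subrr normr0 ltW.
have EVT (G : 'rV[R]_n -> R^o) (A : set 'rV[R]_n) : (forall x, smooth_at G x) ->
    A !=set0 -> compact A -> exists2 c, A c & forall t, A t -> G c <= G t.
  move=> /smooth_cont cG A0 cA.
  have [c Ac cmin] := EVT_min_rV A0 cA (continuous_subspaceT cG).
  by exists c => [|t At]; [rewrite inE in Ac|apply: cmin; rewrite inE].
have [k Hk] : exists k, forall y, `|y - xs| = e -> f xs < F k y.
  (* The points of the sphere where [N] alone does not lift [f] above [f xs]. There [P] is positive,
     since h = 0 on the sphere gives f >= f xs while N > 0; by compactness [P] is then bounded below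
     on [S] by a positive constant. *)
  pose S := B `&` ([set y | e <= `|y - xs|] `&` [set y | f y + N y <= f xs]).
  have cS : compact S.
    apply: compact_closedI => //; apply: closedI.
      exact: closed_ge_dist.
    apply: (closed_le_fun (F := fun y => f y + N y)).
    by apply: (smooth_cont (fun y => f y + N y)) => x; exact: smooth_atD.
  have [S0|/set0P S0] := eqVneq S set0.
    exists 0 => y ye; rewrite /F mul0r add0r ltNge; apply/negP => le_f.
    have : S y by split; [rewrite /B /= ye | split; rewrite /= ?ye].
    by rewrite S0.
  have [y0 Sy0 minP] := EVT P S sP S0 cS.
  have [m Bm minm] := EVT f B sfx (ex_intro _ xs Bxs) cB.
  have P0 : 0 < P y0.
    rewrite lt_neqAle inner_ge0 andbT eq_sym; apply/eqP => /inner_eq0 hy0.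
    case: Sy0 => By0 [] /=; move=> ey0 fy0.
    have y0e : `|y0 - xs| = e by apply/eqP; rewrite eq_le ey0 andbT.
    have := He y0 By0 hy0; have := N_gt0 _ y0e; lra.
  (* [y0] minimizes [P] on [S] and [m] minimizes [f] on [B]. On [S] the penalty is thus at least f
     xs - f m + 1, which forces F k y > f xs; off [S] the term [N] suffices. *)
  exists ((f xs - f m + 1) / P y0) => y ye.
  have By : B y by rewrite /B /= ye.
  have fm : 0 <= f xs - f m by rewrite subr_ge0; exact: minm.
  rewrite ltNge; apply/negP => le_F.
  have k0 : 0 <= (f xs - f m + 1) / P y0 by apply: divr_ge0; [lra|exact: ltW].
  have Sy : S y.
    split => //; split => /=; first by rewrite ye.
    have := mulr_ge0 k0 (inner_ge0 (h y)); move: le_F; rewrite /F -/(P y); lra.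
  have : (f xs - f m + 1) / P y0 * P y0 <= (f xs - f m + 1) / P y0 * P y.
    by rewrite ler_wpM2l //; exact: minP.
  rewrite divfK ?gt_eqF //; have := minm y By; have := N_gt0 y ye.
  move: le_F; rewrite /F; lra.
have [x Bx minF] := EVT (F k) B (sF k) (ex_intro _ xs Bxs) cB.
have Fxs : F k xs = f xs.
  by rewrite /F /P /N hxs subrr !inner0 mulr0 !addr0.
(* The minimizer is interior: its value is at most F k xs = f xs, which is exceeded on the
   sphere. *)
have xe : `|x - xs| < e.
  rewrite lt_neqAle; apply/andP; split => //; apply/eqP => /Hk.
  by rewrite ltNge -Fxs minF.
(* The multiplier is read off from D_v f + 2k <D_v h, h> + 2 <v, x - xs> = 0. *)
exists x, (- (2 * k) *: h x); split; first exact: lt_le_trans xe ee1.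
move=> v; have : 'D_v (F k) x = 0.
  apply: smooth_at_local_min => //.
  have : nbhs x (ball xs e).
    by apply: open_nbhs_nbhs; split; [exact: ball_open|rewrite -ball_normE /= distrC].
  apply: filterS => y; rewrite -ball_normE /= distrC => /ltW; exact: minF.
have df (G : 'rV[R]_n -> R^o) y : smooth_at G y -> derivable G y v.
  by move=> sG; exact/diff_derivable/smooth_at_differentiable.
rewrite /F deriveD; [|exact: df|apply: df; apply: smooth_atD => //]; last first.
  by apply: smooth_atM => //; exact: smooth_at_cst.
rewrite deriveD; [|apply: df|exact: df]; last first.
  by apply: smooth_atM => //; exact: smooth_at_cst.
rewrite deriveMl; last exact: df.
rewrite !derive_inner; [|exact: smooth_at_differentiable..].
rewrite deriveB ?derive_id ?derive_cst ?subr0; [|exact: derivable_id|exact: derivable_cst].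
rewrite innerZ [inner (x - xs) v]innerC [inner (h x) _]innerC; lra.
Qed.

End Lagrange.

(** * The least-squares multiplier *)

Section Multiplier.
Context {R : realType}.

Lemma Ck_mulmx (V : normedModType R) k (U : set V) m n q
    (A : V -> 'M[R]_(m, n)) (B : V -> 'M[R]_(n, q)) :
  open U -> (forall i j, Ck k U (fun x => A x i j : R^o)) ->
  (forall i j, Ck k U (fun x => B x i j : R^o)) ->
  forall i j, Ck k U (fun x => (A x *m B x) i j : R^o).
Proof.
move=> oU CA CB i j; under eq_fun do rewrite mxE.
apply: (@Ck_sum _ _ R^o k U _ _ xpredT (fun l x => A x i l * B x l j)) => // l _.
exact: CkM.
Qed.

(** If v J^T J = 0 then |v J^T|^2 = 0, and [J^T] has independent rows. *)
Lemma gram_unitmx n p (J : 'M[R]_(n, p)) : \rank J = p -> J^T *m J \in unitmx.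
Proof.
move=> rJ; rewrite -row_free_unit -kermx_eq0; apply/rowV0P => v /sub_kermxP vJJ.
have /inner_eq0 vJ : inner (v *m J^T) (v *m J^T) = 0.
  by rewrite inner_mulmx trmx_mul trmxK mulmxA -(mulmxA v) vJJ mul0mx mxE.
have fJ : row_free J^T by rewrite /row_free mxrank_tr rJ.
by apply: (row_free_inj fJ); rewrite mul0mx.
Qed.

Lemma jacobianE n m (F : 'rV[R]_n -> 'rV[R]_m) x i j :
  differentiable F x -> 'J F x i j = ('D_(delta_mx 0 i) F x) 0 j.
Proof. by move=> dF; rewrite mxE deriveE. Qed.

(* At the points provided by [penalty_stationary], w = mu J^T annihilates
   det(G) w - w J adj(G) J^T with G = J^T J; continuity does the rest, without
   extracting a convergent subsequence. *)
Lemma lagrange_lsq_multiplier n p (f : 'rV[R]_n -> R) (h : 'rV[R]_n -> 'rV[R]_p) xs :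
  smooth_on setT (f : 'rV[R]_n -> R^o) -> smooth_on setT h -> h xs = 0 ->
  \rank ('J h xs) = p ->
  (\forall y \near xs, h y = 0 -> f xs <= f y) ->
  euclid_grad f xs = lsq_multiplier f h xs *m ('J h xs)^T.
Proof.
move=> sf sh hxs rk minf.
(* The added term is the gradient of |x - xs|^2; it vanishes at [xs]. *)
pose w (x : 'rV[R]_n) : 'rV[R]_n := euclid_grad f x + 2 *: (x - xs).
pose J x := 'J h x; pose G x := (J x)^T *m J x.
(* Using determinant and adjugate instead of the inverse of [G] makes [Phi] continuous everywhere,
   even where the rank of [J] drops. *)
pose Phi x := \det (G x) *: w x - w x *m J x *m \adj (G x) *m (J x)^T.
have dh x : differentiable h x by exact/smooth_at_differentiable/smooth_on_setT_at.
have CJ i j : Ck 0 setT (fun x => J x i j : R^o).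
  apply: (@Ck_eq _ _ _ _ _ (fun x => ('D_(delta_mx 0 i) h x) 0 j : R^o) _ openT).
    by move=> x _; rewrite jacobianE.
  by apply: Ck_coord openT _; have [_] := sh 1%N; exact.
have CJT i j : Ck 0 setT (fun x => (J x)^T i j : R^o).
  by under eq_fun do rewrite mxE; exact: CJ.
have CG i j : Ck 0 setT (fun x => G x i j : R^o) by exact: (Ck_mulmx openT).
have Cw i j : Ck 0 setT (fun x => w x i j : R^o).
  rewrite ord1; apply: (@Ck_eq _ _ _ _ _ (fun x =>
    'D_(delta_mx 0 j) (f : _ -> R^o) x + 2 * (x 0 j + - xs 0 j) : R^o) _ openT).
    by move=> x _; rewrite !mxE.
  apply: (CkD openT); first by have [_] := sf 1%N; exact.
  apply: (CkM openT); first exact: Ck_cst.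
  by apply: (CkD openT); [move=> x _; exact: coord_continuous|exact: Ck_cst].
have CPhi i : Ck 0 setT (fun x => Phi x 0 i : R^o).
  have C2 := Ck_mulmx openT (Ck_mulmx openT (Ck_mulmx openT Cw CJ)
    (fun a b => Ck_adj a b openT CG)) CJT 0 i.
  have C1 := CkM openT (Ck_det openT CG) (Cw 0 i).
  apply: (@Ck_eq _ _ _ _ _ (fun x => \det (G x) * w x 0 i +
    -1 * (w x *m J x *m \adj (G x) *m (J x)^T) 0 i : R^o) _ openT).
    by move=> x _; rewrite [in RHS]mxE [in RHS]mxE [X in _ = _ + X]mxE mulN1r.
  by apply: (CkD openT) => //; apply: (CkM openT) => //; exact: Ck_cst.
(* If a coordinate of [Phi xs] were nonzero, it would stay nonzero on a ball around [xs]; but that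
   ball contains a penalized stationary point, where [Phi] vanishes. *)
have Phi0 : Phi xs = 0.
  apply/rowP => i; rewrite [RHS]mxE; apply/eqP; apply: contraT => nz.
  have /cvgrPdist_lt/(_ `|Phi xs 0 i|) := CPhi i xs I.
  rewrite normr_gt0 => /(_ nz)/nbhs_normP[e /= e0 He].
  have [x [mu [xe st]]] := penalty_stationary sf sh hxs minf e0.
  have wE : w x = mu *m (J x)^T.
    apply/rowP => k; rewrite !mxE.
    have := st (delta_mx 0 k); rewrite (_ : inner (delta_mx 0 k) (x - xs) = (x - xs) 0 k).
      by rewrite !mxE => ->; apply: eq_bigr => j _; rewrite mxE jacobianE.
    rewrite /inner (bigD1 k) //= big1 ?addr0 => [|j jk].
      by rewrite [delta_mx _ _ _ _]mxE !eqxx mul1r.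
    by rewrite mxE (negPf jk) andbF mul0r.
  have : Phi x = 0.
    rewrite /Phi wE -(mulmxA mu) -/(G x) -(mulmxA mu (G x)) mul_mx_adj.
    by rewrite mul_mx_scalar -scalemxAl subrr.
  have := He x; rewrite /= distrC => /(_ xe) lt0 Ex.
  by move: lt0; rewrite Ex [X in _ - X]mxE subr0 ltxx.
have uG : G xs \in unitmx by exact: gram_unitmx.
have w0 : w xs = euclid_grad f xs by rewrite /w subrr scaler0 addr0.
have E : euclid_grad f xs = euclid_grad f xs *m J xs *m invmx (G xs) *m (J xs)^T.
  apply: (scalerI (a := \det (G xs))); first by rewrite -unitfE -unitmxE.
  move: Phi0; rewrite /Phi w0 => /eqP; rewrite subr_eq0 => /eqP ->.
  rewrite /invmx uG -scalemxAr -scalemxAl scalerA mulfV ?scale1r //.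
  by rewrite -unitfE -unitmxE.
rewrite {1}E /lsq_multiplier trmx_mul trmxK trmx_mul trmxK trmx_inv trmx_mul trmxK.
by rewrite !mulmxA.
Qed.

Lemma euclid_grad_lagrangian n p (f : 'rV[R]_n -> R) (h : 'rV[R]_n -> 'rV[R]_p) x lam :
  differentiable (f : 'rV[R]_n -> R^o) x -> differentiable h x ->
  euclid_grad (fun y => lagrangian f h y lam) x =
  euclid_grad f x - lam *m ('J h x)^T.
Proof.
move=> df dh; apply/rowP => i; rewrite [LHS]mxE [in RHS]mxE [in RHS]mxE.
rewrite [X in _ = _ + X]mxE /lagrangian.
rewrite deriveB; [|exact: diff_derivable|]; last first.
  by apply/diff_derivable/differentiable_inner; first exact: differentiable_cst.
rewrite (derive_inner (A := fun=> lam)) ?derive_cst ?inner0 ?add0r //.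
congr (_ - _); rewrite [RHS]mxE; apply: eq_bigr => j _.
by rewrite [in RHS]mxE jacobianE.
Qed.

End Multiplier.

(** * Second derivatives along curves *)

Section SecondDerivative.
Context {R : realType}.

Lemma smooth_at_grad n (Phi : 'rV[R]_n -> R) x :
  smooth_at (Phi : 'rV[R]_n -> R^o) x -> smooth_at (euclid_grad Phi) x.
Proof.
move=> sP; apply: smooth_at_rV => i; under eq_fun do rewrite mxE.
exact: smooth_at_derive.
Qed.

Lemma inner_grad n (Phi : 'rV[R]_n -> R) x v :
  differentiable (Phi : 'rV[R]_n -> R^o) x ->
  'D_v (Phi : 'rV[R]_n -> R^o) x = inner v (euclid_grad Phi x).
Proof.
by move=> dP; rewrite derive_delta //; apply: eq_bigr => i _; rewrite mxE.
Qed.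

Lemma derive1_comp_rV n (W : normedModType R) (Phi : 'rV[R]_n -> W)
    (gam : R -> 'rV[R]_n) t :
  differentiable (gam : R^o -> 'rV[R]_n) t -> differentiable Phi (gam t) ->
  derive1 (Phi \o gam : R -> W) t = 'D_(derive1 gam t) Phi (gam t).
Proof.
by move=> dg dP; rewrite !derive1E (derive_comp (F := gam : R^o -> _)).
Qed.

Lemma near_smooth_comp n (W : normedModType R) (Phi : 'rV[R]_n -> W)
    (gam : R -> 'rV[R]_n) :
  smooth_at (gam : R^o -> 'rV[R]_n) 0 -> smooth_at Phi (gam 0) ->
  \forall t \near (0 : R), smooth_at Phi (gam t).
Proof.
by move=> /smooth_at_continuous cg /smooth_at_near; exact: cg.
Qed.

Lemma near_eq_derive1 (W : normedModType R) (F G : R -> W) t :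
  (\forall s \near t, F s = G s) -> derive1 F t = derive1 G t.
Proof. by move=> FG; rewrite !derive1E; exact: (near_eq_derive (V := R^o)). Qed.

Lemma near_eq_derive1_derive1 (W : normedModType R) (F G : R -> W) t :
  (\forall s \near t, F s = G s) -> derive1 (derive1 F) t = derive1 (derive1 G) t.
Proof.
move=> /near_join FG; apply: near_eq_derive1.
by apply: filterS FG => s; exact: near_eq_derive1.
Qed.

(** Differentiating <gam', grad Phi> along [gam] leaves an acceleration term <gam'', grad Phi>,
    which vanishes at a critical point; only the velocity then matters. *)
Lemma second_derivative_critical n (Phi : 'rV[R]_n -> R) (gam : R -> 'rV[R]_n) :
  smooth_at (gam : R^o -> 'rV[R]_n) 0 ->
  smooth_at (Phi : 'rV[R]_n -> R^o) (gam 0) ->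
  euclid_grad Phi (gam 0) = 0 ->
  derive1 (derive1 (Phi \o gam : R -> R^o)) 0 =
  inner (derive1 gam 0) ('D_(derive1 gam 0) (euclid_grad Phi) (gam 0)).
Proof.
move=> sg sP gP0.
have nsP := near_smooth_comp sg sP.
have dgam : smooth_at (derive1 gam : R^o -> 'rV[R]_n) 0.
  rewrite (_ : derive1 gam = 'D_(1 : R^o) (gam : R^o -> 'rV[R]_n)).
    exact: smooth_at_derive.
  by apply/funext => t; rewrite derive1E.
pose E t : 'rV[R]_n := euclid_grad Phi (gam t).
have sE : smooth_at (E : R^o -> 'rV[R]_n) 0.
  exact: (smooth_at_comp_rV (F := gam : R^o -> _) sg (smooth_at_grad sP)).
have D1 : \forall t \near (0 : R),
    derive1 (Phi \o gam : R -> R^o) t = inner (derive1 gam t) (E t).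
  have sgn := smooth_at_near sg.
  apply: filterS2 nsP sgn => t sPt sgt.
  rewrite derive1_comp_rV ?inner_grad //; exact: smooth_at_differentiable.
rewrite (near_eq_derive1 D1) derive1E.
rewrite (derive_inner (V := R^o)); [|exact: smooth_at_differentiable..].
rewrite -!derive1E (gP0 : E 0 = 0) [X in X + _]innerC inner0 add0r; congr (inner _ _).
rewrite /E derive1_comp_rV //; first exact: smooth_at_differentiable.
by apply/smooth_at_differentiable; exact: smooth_at_grad.
Qed.

(* The h-term of L vanishes along curves in M, and L(., lambda) is critical at
   xs, so D^2 L(v, v) is the second derivative of f along any curve of M. *)
Lemma D2_lagrangian_curve n p (f : 'rV[R]_n -> R) (h : 'rV[R]_n -> 'rV[R]_p) xs
    (gam : R -> 'rV[R]_n) v :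
  smooth_on setT (f : 'rV[R]_n -> R^o) -> smooth_on setT h ->
  \rank ('J h xs) = p ->
  (\forall y \near xs, h y = 0 -> f xs <= f y) ->
  sub_curve [set x | h x = 0] xs v gam ->
  inner v (D2_lagrangian f h xs (lsq_multiplier f h xs) v) =
  derive1 (derive1 (f \o gam : R -> R^o)) 0.
Proof.
move=> sf sh rk minf [g0 gM sg gv].
have hxs : h xs = 0 by have := nbhs_singleton gM; rewrite /= g0.
set lam := lsq_multiplier f h xs.
have sfx := smooth_on_setT_at xs sf; have shx := smooth_on_setT_at xs sh.
have sL : smooth_at ((fun y => lagrangian f h y lam) : 'rV[R]_n -> R^o) xs.
  rewrite (_ : (fun y => _) = fun y => f y + -1 * inner lam (h y)).
    apply: smooth_atD => //; apply: smooth_atM; first exact: smooth_at_cst.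
    by apply: smooth_at_inner => //; exact: smooth_at_cst.
  by apply/funext => y; rewrite /lagrangian mulN1r.
have gL0 : euclid_grad (fun y => lagrangian f h y lam) xs = 0.
  rewrite euclid_grad_lagrangian; [|exact: smooth_at_differentiable..].
  by rewrite (lagrange_lsq_multiplier sf sh hxs rk minf) subrr.
have := @second_derivative_critical n (fun y => lagrangian f h y lam) gam sg.
rewrite g0 gv => /(_ sL gL0) <-.
apply: near_eq_derive1_derive1; apply: filterS gM => t /= ht.
by rewrite /lagrangian ht innerC inner0 subr0.
Qed.

End SecondDerivative.

(** * Tangent vectors in charts *)

Section Charts.
Context {R : realType} {T : Type} {d : nat}.
Variables (A : set (chart R T d)) (X : set T).
Hypothesis atlasA : is_atlas A X.
Implicit Types (c : chart R T d) (q : T) (F : T -> R).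

Lemma chart_invK c q : A c -> chart_dom c q -> chart_inv c (chart_map c q) = q.
Proof. by have [_ _ + _ _] := atlasA; exact. Qed.

Lemma near_chart c q : A c -> chart_dom c q ->
  \forall y \near chart_map c q,
    chart_dom c (chart_inv c y) /\ chart_map c (chart_inv c y) = y.
Proof.
move=> Ac cq; have [_ _ _ /(_ c Ac) oc _] := atlasA.
have : nbhs (chart_map c q) (chart_map c @` chart_dom c).
  by apply: open_nbhs_nbhs; split => //; exists q.
by apply: filterS => _ [z cz <-]; rewrite chart_invK.
Qed.

Lemma smooth_at_transition c1 c2 q : A c1 -> A c2 ->
  chart_dom c1 q -> chart_dom c2 q ->
  smooth_at (chart_map c2 \o chart_inv c1) (chart_map c1 q) /\
  \forall y \near chart_map c1 q, chart_dom c2 (chart_inv c1 y).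
Proof.
move=> A1 A2 c1q c2q; have [_ _ _ _ /(_ c1 c2 A1 A2)/=[oU sU]] := atlasA.
have Uq : (chart_map c1 @` (chart_dom c1 `&` chart_dom c2)) (chart_map c1 q).
  by exists q.
split; first by eexists; split; [exact: oU|exact: Uq|exact: sU].
have := open_nbhs_nbhs (conj oU Uq).
by apply: filterS => _ [z [c1z c2z] <-]; rewrite chart_invK.
Qed.

(** [man_smooth_at] asks for one chart only; transition maps carry smoothness to every other chart
    around [q]. *)
Lemma man_smooth_at_chart F c q : A c -> chart_dom c q -> man_smooth_at A F q ->
  smooth_at (F \o chart_inv c : 'rV[R]_d -> R^o) (chart_map c q).
Proof.
move=> Ac cq [c1 [Ac1 c1q sF]].
have [st near_c1] := smooth_at_transition Ac Ac1 cq c1q.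
have sFt : smooth_at ((F \o chart_inv c1 : _ -> R^o) \o (chart_map c1 \o chart_inv c))
    (chart_map c q).
  by apply: smooth_at_comp => //=; rewrite chart_invK.
by apply: smooth_at_eq sFt; apply: filterS near_c1 => y /= c1y; rewrite chart_invK.
Qed.

Lemma near_man_smooth F c q : A c -> chart_dom c q -> man_smooth_at A F q ->
  \forall y \near chart_map c q, man_smooth_at A F (chart_inv c y).
Proof.
move=> Ac cq sF; have := smooth_at_near (man_smooth_at_chart Ac cq sF).
by apply: filterS2 (near_chart Ac cq) => y [cy cyE] sy; exists c; split; rewrite ?cyE.
Qed.

(** The tangent vector with components [w] in the chart [c]. The value 0 on nonsmooth functions
    matches [velocity], so that the two can be equal as functionals. *)
Definition chart_vec c (w : 'rV[R]_d) q : tvec R T :=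
  fun F => if `[< man_smooth_at A F q >]
           then 'D_w (F \o chart_inv c : 'rV[R]_d -> R^o) (chart_map c q) else 0.

Lemma velocity_chart c q gam : A c -> gam 0 = q ->
  (\forall t \near (0 : R), chart_dom c (gam t)) ->
  smooth_at (chart_map c \o gam : R^o -> 'rV[R]_d) 0 ->
  velocity A q gam = chart_vec c (derive1 (chart_map c \o gam : R -> 'rV[R]_d) 0) q.
Proof.
move=> Ac g0 gc sg; apply/funext => F; rewrite /velocity /chart_vec.
case: asboolP => // sF; have cq : chart_dom c q by rewrite -g0; exact: nbhs_singleton gc.
have := man_smooth_at_chart Ac cq sF; rewrite -g0 => sFc.
rewrite -(derive1_comp_rV (Phi := F \o chart_inv c : _ -> R^o)
  (gam := chart_map c \o gam)); [|exact: smooth_at_differentiable..].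
by apply: near_eq_derive1; apply: filterS gc => t ct; rewrite /= chart_invK.
Qed.

Lemma man_curve_chart c q gam : A c -> chart_dom c q -> man_curve A q gam ->
  (\forall t \near (0 : R), chart_dom c (gam t)) /\
  smooth_at (chart_map c \o gam : R^o -> 'rV[R]_d) 0.
Proof.
move=> Ac cq [g0 [c1 [Ac1 gc1 sg1]]].
have c1q : chart_dom c1 q by rewrite -g0; exact: nbhs_singleton gc1.
have [st near_c] := smooth_at_transition Ac1 Ac c1q cq.
have gc : \forall t \near (0 : R), chart_dom c (gam t).
  have cg := smooth_at_continuous sg1; rewrite -g0 in near_c.
  have H : \forall t \near (0 : R), chart_dom c (chart_inv c1 (chart_map c1 (gam t))).
    exact: cg _ near_c.
  by apply: filterS2 H gc1 => t + c1t; rewrite chart_invK.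
split => //; rewrite -g0 in st.
apply: (@smooth_at_eq _ _ _
  ((chart_map c \o chart_inv c1) \o (chart_map c1 \o gam)) _ (0 : R^o)).
  by apply: filterS gc1 => t c1t; rewrite /= chart_invK.
exact: (smooth_at_comp_rV (F := chart_map c1 \o gam : R^o -> _)).
Qed.

Lemma man_tangent_chart c q u : A c -> chart_dom c q -> man_tangent A q u ->
  exists w, u = chart_vec c w q.
Proof.
move=> Ac cq [gam cgam ->]; have [gc sg] := man_curve_chart Ac cq cgam.
by exists (derive1 (chart_map c \o gam : R -> 'rV[R]_d) 0); exact: velocity_chart Ac cgam.1 gc sg.
Qed.

(** It is the velocity of the curve that is a straight line of direction [w] in the chart. *)
Lemma chart_vec_tangent c w q : A c -> chart_dom c q ->
  man_tangent A q (chart_vec c w q).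
Proof.
move=> Ac cq; pose l (t : R) := chart_map c q + t *: w.
have l0 : l 0 = chart_map c q by rewrite /l scale0r addr0.
have dl (t : R) := is_derive_line (chart_map c q) w t.
have sl : smooth_at (l : R^o -> 'rV[R]_d) 0.
  apply: smooth_atD; first exact: smooth_at_cst.
  exact: smooth_at_scalel (smooth_at_id _).
have near_l : \forall t \near (0 : R), chart_dom c (chart_inv c (l t)) /\
    chart_map c (chart_inv c (l t)) = l t.
  have := near_chart Ac cq; rewrite -l0 => H.
  exact: (smooth_at_continuous sl) _ H.
have sg : smooth_at (chart_map c \o (chart_inv c \o l) : R^o -> 'rV[R]_d) 0.
  by apply: smooth_at_eq sl; apply: filterS near_l => t [].
have g0 : (chart_inv c \o l) 0 = q by rewrite /= l0 chart_invK.
have gc : \forall t \near (0 : R), chart_dom c ((chart_inv c \o l) t).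
  by apply: filterS near_l => t [].
exists (chart_inv c \o l); first by split => //; exists c.
rewrite (velocity_chart Ac g0 gc sg); congr (chart_vec _ _ _).
rewrite (@near_eq_derive1 _ _ _ l); last by apply: filterS near_l => t [].
by rewrite derive1E; have [_ ->] := dl 0.
Qed.

Lemma man_smooth_chart_coord c q i : A c -> chart_dom c q ->
  man_smooth_at A (fun z => chart_map c z 0 i) q.
Proof.
move=> Ac cq; exists c; split => //.
apply: (@smooth_at_eq _ _ _ (fun y : 'rV[R]_d => y 0 i : R^o)).
  by apply: filterS (near_chart Ac cq) => y [_ /= ->].
exact: (smooth_at_coord (F := id)) (smooth_at_id _).
Qed.

(** Applying the vector to the coordinate functions of the chart recovers the components. *)
Lemma chart_vec_inj c q : A c -> chart_dom c q -> injective (chart_vec c ^~ q).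
Proof.
move=> Ac cq.
suff E w i : chart_vec c w q (fun z => chart_map c z 0 i) = w 0 i.
  by move=> w w' ww'; apply/rowP => i; rewrite -!E ww'.
rewrite /chart_vec asboolT; last exact: man_smooth_chart_coord.
rewrite (@near_eq_derive _ _ _ _ (fun y : 'rV[R]_d => y 0 i : R^o)).
  by rewrite derive_coord ?derive_id //; exact: derivable_id.
by apply: filterS (near_chart Ac cq) => y [_ /= ->].
Qed.

Lemma chart_vec_field c w q : A c -> chart_dom c q ->
  man_field_at A X (chart_vec c w) q.
Proof.
move=> Ac cq; exists (chart_dom c); split => //.
  have [domX _ _ _ trA] := atlasA; split; first exact: domX.
  by move=> c' Ac'; rewrite setIC; have [] := trA c' c Ac' Ac.
move=> q' cq'; split; first exact: chart_vec_tangent.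
move=> F sF; exists c; split => //.
have sFc := man_smooth_at_chart Ac cq' sF.
apply: smooth_at_eq (smooth_at_derive w sFc).
apply: filterS2 (near_man_smooth Ac cq' sF) (near_chart Ac cq') => y sFy [_ cyE].
by rewrite /= /chart_vec asboolT // cyE.
Qed.

End Charts.

(** * Local sections of the projection *)

Lemma derive_addl (R : realType) (V W : normedModType R) (F : V -> W) (a : W) x v :
  derivable F x v -> 'D_v (fun y => a + F y) x = 'D_v F x.
Proof.
move=> dF; have dc : derivable (cst a : V -> W) x v by exact: derivable_cst.
by have := deriveD dc dF; rewrite derive_cst add0r.
Qed.

Lemma derive_affine (R : realType) m n (B : 'M[R]_(m, n)) (a : 'rV[R]_n) (x v : 'rV[R]_m) :
  'D_v (fun u : 'rV[R]_m => a + u *m B) x = v *m B.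
Proof.
pose L : {linear 'rV[R]_m -> 'rV[R]_n} := mulmxr B.
have cL : continuous L := @rV_linear_continuous _ _ _ L.
have dL : differentiable L x by exact: linear_differentiable.
have dvL : derivable L x v by exact: diff_derivable.
have -> : (fun u : 'rV[R]_m => a + u *m B) = (fun u => a + L u) by [].
rewrite (derive_addl a dvL).
by rewrite (deriveE _ dL) diff_lin.
Qed.

Section LocalSection.
Context {R : realType} {n d : nat}.
Variables (M : set 'rV[R]_n) (sim : 'rV[R]_n -> 'rV[R]_n -> Prop).
Variable A : set (chart R (set 'rV[R]_n) d).
Local Notation proj := (qproj M sim).

(** [Dproj] is defined through a chosen curve. Returning that very curve allows computing in the
    chart without proving independence of the choice. *)
Lemma Dproj_chart x c v (G : 'rV[R]_n -> 'rV[R]_d) :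
  is_atlas A (quotient_set M sim) -> A c ->
  (\forall y \near x, M y -> chart_dom c (proj y)) ->
  smooth_at G x ->
  (\forall y \near x, M y -> chart_map c (proj y) = G y) ->
  sub_tangent M x v ->
  exists gam, [/\ sub_curve M x v gam,
    smooth_at (chart_map c \o proj \o gam : R^o -> 'rV[R]_d) 0,
    (\forall t \near (0 : R), chart_map c (proj (gam t)) = G (gam t)) &
    Dproj M sim A x v =
    chart_vec A c (derive1 (chart_map c \o proj \o gam : R -> 'rV[R]_d) 0) (proj x)].
Proof.
move=> atlasA Ac cM sG GE [gam0 gam0P].
pose gam := xget (cst x) [set gam | sub_curve M x v gam].
have gamP : sub_curve M x v gam.
  by apply: (@xgetPex _ _ [set gam | sub_curve M x v gam]); exists gam0.
have [g0 gM sg gv] := gamP.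
have cg := smooth_at_continuous sg; rewrite -g0 in cM GE sG.
have gc : \forall t \near (0 : R), chart_dom c (proj (gam t)).
  have H : \forall t \near (0 : R), M (gam t) -> chart_dom c (proj (gam t)).
    exact: cg _ cM.
  by apply: filterS2 gM H => t Mt; exact.
have gG : \forall t \near (0 : R), chart_map c (proj (gam t)) = G (gam t).
  have H : \forall t \near (0 : R), M (gam t) ->
      chart_map c (proj (gam t)) = G (gam t) by exact: cg _ GE.
  by apply: filterS2 gM H => t Mt; exact.
have sc : smooth_at (chart_map c \o proj \o gam : R^o -> 'rV[R]_d) 0.
  apply: (@smooth_at_eq _ _ _ (G \o gam) _ (0 : R^o)).
    by apply: filterS gG => t /= ->.
  exact: (smooth_at_comp_rV (F := gam : R^o -> _)).
exists gam; split => //.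
by rewrite /Dproj -/gam (velocity_chart atlasA Ac _ gc sc) //= g0.
Qed.

(* The section is y |-> psi(a + s(y) B), where psi is the inverse of a slice
   chart of M, the rows of B are lifts of the coordinate vectors, and s comes
   from the inverse function theorem. *)
Lemma local_section x c :
  embedded_submanifold M -> is_atlas A (quotient_set M sim) ->
  (forall u, man_tangent A (proj x) u ->
    exists2 v, sub_tangent M x v & Dproj M sim A x v = u) ->
  M x -> A c -> (\forall y \near x, M y -> chart_dom c (proj y)) ->
  sub_smooth_at M (chart_map c \o proj) x ->
  exists sec : 'rV[R]_d -> 'rV[R]_n,
    [/\ smooth_at sec (chart_map c (proj x)), sec (chart_map c (proj x)) = x &
        \forall y \near chart_map c (proj x),
          M (sec y) /\ proj (sec y) = chart_inv c y].
Proof.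
move=> [m _ /(_ x) embM] atlasA subm Mx Ac cM [G sG GE].
have cx : chart_dom c (proj x) by exact: nbhs_singleton cM Mx.
have [U [phi [psi [[oU Ux] sphi [oV spsi] psiK MU]]]] := embM Mx.
pose a := phi x.
have Va : (phi @` U) a by exists x.
have phix (i : 'I_n) : (m <= i)%N -> a 0 i = 0 by exact: (MU x Ux).1 Mx i.
have sphix : smooth_at phi x by exists U.
have spsia : smooth_at psi a by exists (phi @` U).
have psia : psi a = x by exact: psiK.
(* Submersivity lifts each coordinate vector to the velocity of a curve in [M]; row [i] of [B] is
   this velocity seen through [phi], hence tangent to the slice. *)
have [B [Bm BG]] : exists B : 'M[R]_(d, n),
    (forall i (j : 'I_n), (m <= j)%N -> B i j = 0) /\
    forall i, 'D_(row i B) (G \o psi) a = delta_mx 0 i.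
  have lift (i : 'I_d) : exists b : 'rV[R]_n,
      (forall j : 'I_n, (m <= j)%N -> b 0 j = 0) /\ 'D_b (G \o psi) a = delta_mx 0 i.
    have [v Mv Dv] := subm _ (chart_vec_tangent atlasA (delta_mx 0 i) Ac cx).
    have [gam [[g0 gM sg gv] sc gG]] := Dproj_chart atlasA Ac cM sG GE Mv.
    (* Injectivity turns an equality of functionals into one of components: [delta_mx 0 i] is the
       velocity of the projected curve in the chart. *)
    rewrite Dv => /(chart_vec_inj atlasA Ac cx) ->.
    have gU : \forall t \near (0 : R), U (gam t).
      have : nbhs (gam 0) U by rewrite g0; exact: open_nbhs_nbhs.
      exact: (smooth_at_continuous sg).
    have spg : smooth_at (phi \o gam : R^o -> 'rV[R]_n) 0.
      by apply: (smooth_at_comp_rV (F := gam : R^o -> _)) => //; rewrite g0.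
    exists (derive1 (phi \o gam : R -> 'rV[R]_n) 0); split.
      move=> j mj; rewrite derive1E -derive_coord; last first.
        exact/diff_derivable/smooth_at_differentiable.
      rewrite (@near_eq_derive _ R^o R^o _ (fun=> 0)) ?derive_cst //.
      by apply: filterS2 gU gM => t Ut Mt; exact: (MU _ Ut).1.
    have ga : (phi \o gam) 0 = a by rewrite /= g0.
    rewrite -ga -derive1_comp_rV; first last.
    - rewrite ga; apply: smooth_at_differentiable; apply: smooth_at_comp_rV => //.
      by rewrite psia.
    - exact: smooth_at_differentiable.
    apply: near_eq_derive1; apply: filterS2 gU gG => t Ut /= ->.
    by rewrite psiK.
  have [b bP] := choice lift.
  exists (\matrix_(i, j) b i 0 j); split.
    by move=> i j mj; rewrite mxE; exact: (bP i).1.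
  move=> i; rewrite -(bP i).2; congr ('D_ _ _ _).
  by apply/rowP => j; rewrite !mxE.
pose l (u : 'rV[R]_d) := a + u *m B.
have l0 : l 0 = a by rewrite /l mul0mx addr0.
have sl u : smooth_at l u.
  apply: smooth_atD; first exact: smooth_at_cst.
  exact: (smooth_at_linear (L := mulmxr B) (@rV_linear_continuous _ _ _ _)
            (smooth_at_id u)).
have spl : smooth_at (psi \o l) 0.
  by apply: smooth_at_comp_rV; [exact: sl|rewrite l0].
(* The projection, read in the chart, along the d-dimensional plane of lifts; its derivative at 0 is
   the identity by the choice of [B]. *)
pose K := G \o (psi \o l).
have sK : smooth_at K 0.
  by apply: smooth_at_comp_rV => //=; rewrite l0 psia.
have K0 : K 0 = chart_map c (proj x).
  by rewrite /K /= l0 psia -(nbhs_singleton GE).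
have DK v : 'D_v K 0 = v.
  rewrite [RHS]row_sum_delta derive_delta; last exact: smooth_at_differentiable.
  apply: eq_bigr => i _; congr (_ *: _); rewrite -[RHS]BG /K.
  rewrite (derive_comp (F := l) (G := G \o psi)); first last.
  - rewrite l0; apply: smooth_at_differentiable; apply: smooth_at_comp_rV => //.
    by rewrite psia.
  - exact: smooth_at_differentiable.
  rewrite l0; congr ('D_ _ _ _).
  by rewrite /l derive_affine -rowE.
have [s [ss s0 Ks]] := local_right_inverse sK DK.
have ssec : smooth_at (psi \o l \o s) (K 0).
  by apply: smooth_at_comp_rV => //; rewrite s0.
have sec0 : (psi \o l \o s) (K 0) = x by rewrite /= s0 l0.
rewrite -K0; exists (psi \o l \o s); split => //.
have near_x : \forall y \near K 0, (M ((psi \o l \o s) y) -> chart_dom c (proj ((psi \o l \o s) y)))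
    /\ (M ((psi \o l \o s) y) -> chart_map c (proj ((psi \o l \o s) y)) = G ((psi \o l \o s) y)).
  have H : \forall y \near (psi \o l \o s) (K 0), (M y -> chart_dom c (proj y)) /\
      (M y -> (chart_map c \o proj) y = G y).
    by rewrite sec0; apply: filterS2 cM GE.
  exact: (smooth_at_continuous ssec) _ H.
have near_V : \forall y \near K 0, (phi @` U) (l (s y)).
  have sls : smooth_at (l \o s) (K 0) by apply: smooth_at_comp_rV => //; exact: sl.
  have : nbhs ((l \o s) (K 0)) (phi @` U) by rewrite /= s0 l0; exact: open_nbhs_nbhs.
  exact: (smooth_at_continuous sls).
near=> y.
have Vy : (phi @` U) (l (s y)) by near: y.
have Ky : K (s y) = y by near: y.
(* Both [a] and the rows of [B] vanish in the coordinates from [m] on, so the point stays in the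
   slice representing [M]. *)
have Msec : M (psi (l (s y))).
  case: Vy => z Uz zE; rewrite -zE psiK //; apply/(MU _ Uz) => j mj.
  rewrite zE /l !mxE phix // add0r big1 // => i _.
  by rewrite Bm // mulr0.
have [cy cyE] : (M ((psi \o l \o s) y) -> chart_dom c (proj ((psi \o l \o s) y)))
    /\ (M ((psi \o l \o s) y) -> chart_map c (proj ((psi \o l \o s) y)) = G ((psi \o l \o s) y)).
  by near: y.
split; first exact: Msec.
rewrite -[LHS](chart_invK atlasA Ac (cy Msec)) cyE //.
by congr (chart_inv c _); exact: Ky.
Unshelve. all: by end_near. Qed.

End LocalSection.

(** * The Hessian at a critical point, and the conclusion *)

Lemma quotient_fun_proj (R : realType) n (f : 'rV[R]_n -> R) (M : set 'rV[R]_n) sim x :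
  equivalence_on M sim -> (forall x y, M x -> M y -> sim x y -> f x = f y) ->
  M x -> quotient_fun f (qproj M sim x) = f x.
Proof.
move=> [refl _ _] fsim Mx.
have [Mz zx] : qproj M sim x (xget 0 (qproj M sim x)).
  by apply: (@xgetPex _ 0 (qproj M sim x)); exists x; split => //; exact: refl.
exact: fsim.
Qed.

(* Metric compatibility with a coordinate field Z equal to u at q; the term
   g(grad F, nabla Z) = (nabla Z) F vanishes since F is critical. *)
Lemma hessian_chart (R : realType) (T : Type) d (A : set (chart R T d)) (X : set T)
    (g : T -> tvec R T -> tvec R T -> R) nabla (F : T -> R) gradF q c w :
  is_atlas A X -> man_metric A X g -> levi_civita A X g nabla ->
  is_gradient A X g F gradF -> A c -> chart_dom c q ->
  man_smooth_at A F q ->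
  euclid_grad (F \o chart_inv c) (chart_map c q) = 0 ->
  g q (chart_vec A c w q) (nabla q (chart_vec A c w q) gradF) =
  inner w ('D_w (euclid_grad (F \o chart_inv c)) (chart_map c q)).
Proof.
move=> atlasA metg lc gradP Ac cq sF critF.
have [domX _ _ _ _] := atlasA; have Xq : X q by exact: domX cq.
set u := chart_vec A c w q; pose Z := chart_vec A c w.
have tu : man_tangent A q u by exact: (chart_vec_tangent atlasA w Ac cq).
have fZ : man_field_at A X Z q by exact: chart_vec_field.
have [fG _] := gradP q Xq.
have [_ symg _ smg] := metg q Xq.
have sFc := man_smooth_at_chart atlasA Ac cq sF.
have crit v : man_tangent A q v -> v F = 0.
  move=> /(man_tangent_chart atlasA Ac cq)[w' ->]; rewrite /chart_vec asboolT //.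
  rewrite inner_grad; last exact: smooth_at_differentiable.
  by rewrite critF innerC inner0.
have := lc_metric lc Xq tu fG fZ.
have [_ gradE] := gradP q Xq.
rewrite gradE; last exact: (lc_tangent lc).
rewrite crit ?addr0; last exact: (lc_tangent lc).
rewrite symg //; last exact: (lc_tangent lc).
move=> <-; rewrite /u /chart_vec asboolT; last exact: smg.
(* Near [q], g(grad F, Z) = Z F is the derivative of [F] in the chart along [w]; differentiating
   once more along [w] gives the second derivative form. *)
rewrite (@near_eq_derive _ _ _ _ (fun y => inner w (euclid_grad (F \o chart_inv c) y) : R^o)).
  rewrite derive_inner; [|exact: differentiable_cst|].
    by rewrite derive_cst inner0 add0r.
  by apply/smooth_at_differentiable; exact: smooth_at_grad.
apply: filterS3 (near_man_smooth atlasA Ac cq sF) (near_chart atlasA Ac cq)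
  (smooth_at_near sFc) => y sFy [cy cyE] sFcy.
have [_ gradEy] := gradP _ (domX c Ac _ cy).
rewrite /= gradEy; last exact: (chart_vec_tangent atlasA w Ac cy).
by rewrite /Z /chart_vec asboolT // cyE inner_grad //; exact: smooth_at_differentiable.
Qed.

Theorem theorem3p1 (R : realType) (n p d : nat)
    (f : 'rV[R]_n -> R) (h : 'rV[R]_n -> 'rV[R]_p)
    (M : set 'rV[R]_n) (sim : 'rV[R]_n -> 'rV[R]_n -> Prop)
    (A : set (chart R (set 'rV[R]_n) d))
    (gbar : 'rV[R]_n -> 'rV[R]_n -> 'rV[R]_n -> R)
    (g : set 'rV[R]_n -> tvec R (set 'rV[R]_n) ->
         tvec R (set 'rV[R]_n) -> R)
    (nabla : set 'rV[R]_n -> tvec R (set 'rV[R]_n) ->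
             (set 'rV[R]_n -> tvec R (set 'rV[R]_n)) ->
             tvec R (set 'rV[R]_n))
    (gradf : set 'rV[R]_n -> tvec R (set 'rV[R]_n))
    (xs : 'rV[R]_n) (H : {vspace 'rV[R]_n}) :
  smooth_on setT (f : 'rV[R]_n -> R^o) ->
  smooth_on setT h ->
  M = [set x | h x = 0] ->
  embedded_submanifold M ->
  (forall x, M x -> \rank ('J h x) = p) ->
  equivalence_on M sim ->
  quotient_manifold M sim A ->
  sub_metric M gbar ->
  man_metric A (quotient_set M sim) g ->
  riemannian_quotient M sim A gbar g ->
  (forall x y, M x -> M y -> sim x y -> f x = f y) ->
  isolated_minima A (quotient_set M sim) (quotient_fun f) ->
  levi_civita A (quotient_set M sim) g nabla ->
  is_gradient A (quotient_set M sim) g (quotient_fun f) gradf ->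
  M xs ->
  (\forall y \near xs, M y -> f xs <= f y) ->
  horizontal M sim xs H ->
  let D2L := D2_lagrangian f h xs (lsq_multiplier f h xs) in
  (forall eta, vertical M sim xs eta -> inner eta (D2L eta) = 0) /\
  (forall xi, xi \in H ->
     let xiQ := Dproj M sim A xs xi in
     inner xi (D2L xi) = g (qproj M sim xs) xiQ (nabla (qproj M sim xs) xiQ gradf)).
Proof.
move=> sf sh ME embM rkh equivM [[atlasA _ _] [projS subm]] _ metg _ fsim _ lc gradP.
move=> Mxs minf [HM _ _] D2L.
have minh : \forall y \near xs, h y = 0 -> f xs <= f y by move: minf; rewrite ME.
have D2E v gam : sub_curve M xs v gam ->
    inner v (D2L v) = derive1 (derive1 (f \o gam : R -> R^o)) 0.
  by rewrite ME; apply: D2_lagrangian_curve => //; exact: rkh.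
split.
  move=> eta [gam [g0 gq sg gv]]; rewrite (D2E eta gam).
    rewrite (@near_eq_derive1_derive1 _ _ _ (fun=> f xs)).
      have -> : derive1 ((fun=> f xs) : R -> R^o) = fun=> 0.
        by apply/funext => t; rewrite derive1_cst.
      by rewrite derive1_cst.
    by apply: filterS gq => t [Mt ts]; exact: fsim.
  by split => //; apply: filterS gq => t [].
move=> xi /HM Mxi xiQ.
set q := qproj M sim xs; pose F := quotient_fun f.
have [c [Ac cM sP]] := projS xs Mxs.
have [sec [ssec sec0 secP]] := local_section embM atlasA (subm xs Mxs) Mxs Ac cM sP.
have cq : chart_dom c q by exact: nbhs_singleton cM Mxs.
(* This makes [F] smooth at [q], with [f \o sec] as its expression in the chart. *)
have FsecE : \forall y \near chart_map c q, (f \o sec) y = (F \o chart_inv c) y.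
  by apply: filterS secP => y [My piE]; rewrite /= -piE /F quotient_fun_proj.
have sfsec : smooth_at (f \o sec : 'rV[R]_d -> R^o) (chart_map c q).
  by apply: smooth_at_comp => //; exact: smooth_on_setT_at.
have sFc : smooth_at (F \o chart_inv c : 'rV[R]_d -> R^o) (chart_map c q).
  exact: smooth_at_eq sfsec.
(* The section takes values in [M], so minimality of [xs] on [M] gives an unconstrained local
   minimum in the chart. *)
have critF : euclid_grad (F \o chart_inv c) (chart_map c q) = 0.
  apply/rowP => i; rewrite !mxE; apply: smooth_at_local_min => //.
  have minS : \forall y \near sec (chart_map c q), M y -> f xs <= f y by rewrite sec0.
  have minsec : \forall y \near chart_map c q, M (sec y) -> f xs <= f (sec y).
    exact: (smooth_at_continuous ssec) _ minS.
  rewrite -(nbhs_singleton FsecE) /= sec0.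
  apply: filterS3 FsecE secP minsec => y /= <- [My _].
  exact.
have sF : man_smooth_at A F q by exists c.
have [G sG GE] := sP.
have [gam [gamM sc gG DxiE]] := Dproj_chart atlasA Ac cM sG GE Mxi.
rewrite /xiQ DxiE (hessian_chart _ atlasA metg lc gradP Ac cq sF critF).
rewrite (D2E xi gam gamM); have [g0 gM sg gv] := gamM.
have c0 : (chart_map c \o qproj M sim \o gam) 0 = chart_map c q by rewrite /= g0.
(* Both sides are now second derivatives along the curve underlying [Dproj]; it remains to see that
   F o pi o gam = f o gam near 0. *)
rewrite -c0 -second_derivative_critical //; try by rewrite c0.
apply: near_eq_derive1_derive1.
have gc : \forall t \near (0 : R), M (gam t) -> chart_dom c (qproj M sim (gam t)).
  have cg := smooth_at_continuous sg; rewrite -g0 in cM.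
  exact: cg _ cM.
by apply: filterS2 gM gc => t Mt /(_ Mt) ct; rewrite /= (chart_invK atlasA) // quotient_fun_proj.
Qed.
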